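(* Let $k\geq 1$ be an integer, let $n\geq 2^{4k}$, and let $G$ be a graph of order $n$. (a) If $\mu(G)\geq \mu(S_{n,k})$, then $G$ contains a path $P_{2k+2}$ as a subgraph, unless $G=S_{n,k}$. (b) If $\mu(G)\geq \mu(S_{n,k}^{+})$, then $G$ contains a path $P_{2k+3}$ as a subgraph, unless $G=S_{n,k}^{+}$.
   Context: All graphs are finite and simple. For a graph $G$, $\mu(G)$ denotes the largest eigenvalue (spectral radius) of its adjacency matrix. $P_r$ denotes the path on $r$ vertices. For $1\leq k<n$, $S_{n,k}$ is the join of the complete graph $K_k$ and the edgeless graph $\overline{K}_{n-k}$ (every vertex of a $k$-clique is joined to every vertex of an independent set of $n-k$ vertices); $S_{n,k}^{+}$ is the graph obtained from $S_{n,k}$ by adding one edge inside the independent set of size $n-k$. Equality of graphs is up to isomorphism. One has $\mu(S_{n,k})=(k-1)/2+\sqrt{kn-(3k^2+2k-1)/4}$. *)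

(* Defs.v *)
From HB Require Import structures.
From mathcomp Require Import all_boot all_order all_algebra.
From mathcomp Require Import all_fingroup reals.
Set Implicit Arguments. Unset Strict Implicit. Unset Printing Implicit Defensive.
Import Order.TTheory GRing.Theory Num.Theory.
Local Open Scope ring_scope.

Definition simple_graph (n : nat) (e : rel 'I_n) : Prop :=
  symmetric e /\ irreflexive e.

Definition adj_mx (R : realType) (n : nat) (e : rel 'I_n) : 'M[R]_n :=
  \matrix_(i, j) (e i j)%:R.

Definition is_spectral_radius (R : realType) (n : nat) (e : rel 'I_n) (mu : R)
  : Prop :=
  eigenvalue (adj_mx R e) mu /\
  (forall l : R, eigenvalue (adj_mx R e) l -> l <= mu).

(* S_{n,k} = K_k join (empty graph on n-k vertices):
   vertices 0..k-1 form the clique. *)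
Definition S_edge (n k : nat) : rel 'I_n :=
  fun x y => (x != y) && ((x < k)%N || (y < k)%N).

Definition Splus_edge (n k : nat) : rel 'I_n :=
  fun x y => S_edge k x y ||
    (((x == k :> nat) && (y == k.+1 :> nat)) ||
     ((x == k.+1 :> nat) && (y == k :> nat))).

Definition graph_iso (n : nat) (e1 e2 : rel 'I_n) : Prop :=
  exists s : {perm 'I_n}, forall x y, e1 x y = e2 (s x) (s y).

Definition has_path (n r : nat) (e : rel 'I_n) : Prop :=
  exists f : 'I_r -> 'I_n, injective f /\
    forall i j : 'I_r, (j : nat) = i.+1 -> e (f i) (f j).

Arguments S_edge n k : clear implicits.
Arguments Splus_edge n k : clear implicits.
Arguments has_path n r e : clear implicits.

(* Main.v *)
(* Write mu(B) for the spectral radius of the subgraph induced on B.  For k >= 2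
   choose B maximising mu(B)^(2(2k-1)) / |B|^(2k-2) among the sets
   of vertices where the Perron vector x of G is positive.  Since deleting a
   vertex does not improve the objective, every squared entry of the unit Perron
   vector of B is at least about (k-1)/((2k-1)|B|); hence B is connected, has
   minimum degree at least k, and is large because mu(B)^2 / |B| is below about 2k
   in a graph without P_(2k+3) (the same optimisation with exponents 2 and 1).
   Consider a longest path p in B and a longest path q outside p starting next to
   p.  Spacing the neighbours on p of the two ends of q shows that either q spans
   a clique seeing only one or two further vertices, which the entry bound
   excludes, or every vertex outside p has k neighbours on p in one of k+1
   patterns.  By the pigeonhole principle some k vertices K have many common
   neighbours.  For k = 1 a vertex with the largest entry of x does.
   Once such a hub K is known, path-freeness makes the components of G - K next to
   K stars.  Two star edges would make mu(G)^2 - (k-1) mu(G) smaller than k(n-k);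
   otherwise the component of K embeds in the extremal graph, and comparing x with
   the positive Perron vector of the latter forces equality. *)
Require Import Defs.
From HB Require Import structures.
From mathcomp Require Import all_boot all_order all_algebra.
From mathcomp Require Import all_fingroup reals.
From mathcomp Require Import ring lra zify.
Set Implicit Arguments. Unset Strict Implicit. Unset Printing Implicit Defensive.
Import Order.TTheory GRing.Theory Num.Theory.
Local Open Scope ring_scope.

(** * Symmetric real matrices *)

Section SymmetricForms.
Variables (R : realType) (n : nat).
Implicit Types (M A : 'M[R]_n) (u v z : 'rV[R]_n).

(** [G] may be disconnected and may have vertices of small degree, so degrees can only be controlled
    inside a well-chosen [B]. Write a = k-1. The exponents p = 2(2a+1) and q = 2a are dictated by
    the degree estimate: at degree a, the bound for an optimal [B] reads exactly mu(B)^2 <=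
    k(|B|+a). Minimum degree k thus follows from mu(B)^2 > k(|B|+a). The same inequality for the
    whole graph, mu^2 > k(n+a), comes from the spectral hypothesis, and it passes to the optimum
    because (b+a)^(2a+1) / b^(2a) is nondecreasing in b from b = 2a^2 on. The size of [B] comes from
    the bound on mu(B)^2 / |B|, whose constant is the value at the complete graph on 2k+2 vertices:
    it loses roughly a factor 2^(2k-1) against n, so n >= 2^(4k) leaves a [B] of order 4^k, enough
    for all later numerical estimates. For k = 1 the exponent q is 0 and the objective no longer
    sees |B|, hence the separate argument. The hub is asked for k+3 common neighbours because the
    most demanding path built through it must avoid four given vertices while visiting k-1 fresh
    ones. *)

Definition mxform M u v : R := (u *m M *m v^T) 0 0.

Lemma mxformE M u v : mxform M u v = \sum_i \sum_j M i j * (u 0 i * v 0 j).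
Proof.
rewrite /mxform mxE exchange_big /=; apply: eq_bigr => j _.
rewrite !mxE big_distrl /=; apply: eq_bigr => i _; ring.
Qed.

Lemma mxformC M u v : M^T = M -> mxform M u v = mxform M v u.
Proof.
move=> MT; rewrite !mxformE exchange_big /=; apply: eq_bigr => i _.
by apply: eq_bigr => j _; rewrite -[in LHS]MT mxE [u 0 j * _]mulrC.
Qed.

Lemma mxformDl M a u1 u2 v :
  mxform M (a *: u1 + u2) v = a * mxform M u1 v + mxform M u2 v.
Proof. by rewrite /mxform !mulmxDl -!scalemxAl !mxE. Qed.

Lemma mxform_quad M a b u v : M^T = M ->
  mxform M (a *: u + b *: v) (a *: u + b *: v) =
  a ^+ 2 * mxform M u u + a * b * mxform M u v *+ 2 + b ^+ 2 * mxform M v v.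
Proof.
move=> MT; rewrite mxformDl -[b *: v]addr0 (mxformC u) // mxformDl.
rewrite ![mxform M (b *: v + 0) _]mxformDl.
have z0 w : mxform M 0 w = 0 by rewrite /mxform !mul0mx mxE.
rewrite !z0 (mxformC v (_ + _)) // mxformDl mxformDl z0 (mxformC v u) //; ring.
Qed.

Lemma mxform1 u : mxform 1%:M u u = \sum_i u 0 i ^+ 2.
Proof.
rewrite /mxform mulmx1 mxE; apply: eq_bigr => i _.
by rewrite mxE expr2.
Qed.

Lemma mxform1_ge0 u : 0 <= mxform 1%:M u u.
Proof. by rewrite mxform1 sumr_ge0 // => i _; rewrite sqr_ge0. Qed.

Lemma mxform1_gt0 u : u != 0 -> 0 < mxform 1%:M u u.
Proof.
move=> u0; rewrite lt_neqAle mxform1_ge0 andbT eq_sym; apply: contra u0.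
rewrite mxform1 psumr_eq0 => [/allP h|i _]; last exact: sqr_ge0.
apply/eqP/rowP => i; rewrite mxE; apply/eqP.
by rewrite -sqrf_eq0; apply: h; rewrite mem_index_enum.
Qed.

Lemma mxform_subscalar M a u v :
  mxform (a%:M - M) u v = a * mxform 1%:M u v - mxform M u v.
Proof.
rewrite /mxform mulmxBr mulmxBl mul_mx_scalar mulmx1 -scalemxAl; by rewrite !mxE.
Qed.

(** With [a], [b], [c] the three values of the form, the test vector [c u - b v] gives
    [c (a c - b^2) >= 0], which settles [c > 0]. If [c = 0] the form is affine along [u + t v], and
    a nonzero slope would let it reach -1. *)
Lemma mxform_CauchySchwarz M u v : M^T = M -> (forall z, 0 <= mxform M z z) ->
  mxform M u v ^+ 2 <= mxform M u u * mxform M v v.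
Proof.
move=> MT psd.
have := psd (mxform M v v *: u + (- mxform M u v) *: v).
rewrite mxform_quad //.
have := psd v; set a := mxform M u u; set b := mxform M u v; set c := mxform M v v.
rewrite le_eqVlt => /orP[/eqP c0|c0]; last first.
  move=> h; rewrite -(ler_pM2l c0) -subr_ge0; apply: le_trans h _.
  by rewrite le_eqVlt; apply/orP; left; apply/eqP; ring.
move=> _; rewrite -c0 mulr0.
have hq t : 0 <= a + t * b *+ 2.
  have := psd (1 *: u + t *: v); rewrite mxform_quad // -/a -/b -/c -c0.
  by rewrite expr1n mulr0 addr0 !mul1r.
have [->|b0] := eqVneq b 0; first by rewrite expr0n.
have := hq (- (a + 1) / (b *+ 2)).
have -> : a + - (a + 1) / (b *+ 2) * b *+ 2 = -1 by field.
by rewrite oppr_ge0 ler10.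
Qed.

Lemma mxform_bound M :
  exists2 C, 0 < C & forall z, mxform M z z <= C * mxform 1%:M z z.
Proof.
exists (1 + \sum_i \sum_j `|M i j|) => [|z].
  by rewrite ltr_wpDr // sumr_ge0 // => i _; rewrite sumr_ge0.
apply: le_trans (_ : (\sum_i \sum_j `|M i j|) * mxform 1%:M z z <= _); last first.
  by rewrite mulrDl mul1r lerDr mxform1_ge0.
rewrite mxformE big_distrl /=; apply: ler_sum => i _.
rewrite big_distrl /=; apply: ler_sum => j _.
apply: le_trans (ler_norm _) _; rewrite normrM.
apply: ler_wpM2l => //.
have le1 k : `|z 0 k| ^+ 2 <= mxform 1%:M z z.
  rewrite mxform1 real_normK ?num_real // (bigD1 k) //= lerDl.
  by rewrite sumr_ge0 // => l _; rewrite sqr_ge0.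
have := le1 i; have := le1 j; rewrite normrM.
have := normr_ge0 (z 0 i); have := normr_ge0 (z 0 j); nra.
Qed.

(* If the supremum [lam] of the Rayleigh quotient were not an eigenvalue,
   [lam - A] would be invertible and Cauchy-Schwarz for it would bound the
   quotient away from [lam]. *)
Lemma symmetric_top_eigenvalue A : (0 < n)%N -> A^T = A ->
  exists lam, (forall z, mxform A z z <= lam * mxform 1%:M z z) /\
    exists2 x : 'rV[R]_n, x != 0 & x *m A = lam *: x.
Proof.
move=> n0 AT.
pose E : classical_sets.set R := fun r => exists2 z : 'rV[R]_n, z != 0 &
  r = mxform A z z / mxform 1%:M z z.
have [C C0 hC] := mxform_bound A.
have e1 : (const_mx 1 : 'rV[R]_n) != 0.
  apply/eqP => /rowP /(_ (Ordinal n0)); rewrite !mxE => /eqP.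
  by rewrite oner_eq0.
have En0 : classical_sets.nonempty E.
  pose c : 'rV[R]_n := const_mx 1.
  by exists (mxform A c c / mxform 1%:M c c), c.
have Eub : classical_sets.ubound E C.
  by move=> _ [z z0 ->]; rewrite ler_pdivrMr ?mxform1_gt0.
pose lam := sup E.
have ray z : mxform A z z <= lam * mxform 1%:M z z.
  have [->|z0] := eqVneq z 0.
    by rewrite /mxform !mul0mx !mxE mulr0.
  rewrite -ler_pdivrMr ?mxform1_gt0 //; apply: sup_upper_bound; last by exists z.
  by split => //; exists C.
exists lam; split=> //.
pose M := lam%:M - A.
have MT : M^T = M by rewrite /M linearB /= tr_scalar_mx AT.
have psd z : 0 <= mxform M z z by rewrite mxform_subscalar subr_ge0.
have [/eqP/det0P [x x0 xM]|dM] := eqVneq (\det M) 0.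
  exists x => //; apply/eqP; rewrite -subr_eq0 -oppr_eq0 opprB.
  by rewrite -mul_mx_scalar -mulmxBr xM.
have Mu : M \in unitmx by rewrite unitmxE unitfE.
have [D D0 hD] := mxform_bound (invmx M).
suff : lam <= lam - D^-1 by rewrite lerBrDr gerDl leNgt invr_gt0 D0.
apply: ge_sup => // _ [z z0 ->]; rewrite ler_pdivrMr ?mxform1_gt0 //.
(* For this second argument the inequality reads [N^2 <= (lam N - a) c] with [c <= D N], so
   [N <= D (lam N - a)]. *)
have := mxform_CauchySchwarz z (z *m invmx M) MT psd.
have wM : z *m invmx M *m M = z by rewrite mulmxKV.
have -> : mxform M z (z *m invmx M) = mxform 1%:M z z.
  by rewrite mxformC // /mxform wM mulmx1.
have -> : mxform M (z *m invmx M) (z *m invmx M) = mxform (invmx M) z z.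
  by rewrite /mxform wM trmx_mul trmx_inv MT mulmxA.
have := hD z; have := psd z; rewrite mxform_subscalar; have := mxform1_gt0 z0.
set N := mxform 1%:M z z; set a := mxform A z z; set c := mxform _ z z.
move=> N0 h1 h2 h3; rewrite mulrBl.
have h4 : N <= (lam * N - a) * D.
  rewrite -(ler_pM2r N0); apply: le_trans (_ : (lam * N - a) * c <= _).
    by rewrite -expr2.
  by rewrite -mulrA; apply: ler_wpM2l.
have : D^-1 * N <= lam * N - a by rewrite mulrC ler_pdivrMr.
lra.
Qed.

(** Taking absolute values keeps the norm and, the entries of [A] being nonnegative, does not lower
    the form. So [|x|] is a zero of the semidefinite form of [lam - A], and by Cauchy-Schwarz such a
    zero lies in the kernel. *)
Lemma nonneg_top_eigenvector A : (0 < n)%N -> A^T = A ->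
  (forall i j, 0 <= A i j) ->
  exists lam, (forall z, mxform A z z <= lam * mxform 1%:M z z) /\
    exists x : 'rV[R]_n, [/\ x != 0, forall i, 0 <= x 0 i & x *m A = lam *: x].
Proof.
move=> n0 AT A0; have [lam [ray [x x0 xA]]] := symmetric_top_eigenvalue n0 AT.
exists lam; split=> //; pose y := map_mx Num.norm x; exists y.
have ynz : y != 0.
  apply: contra x0 => /eqP /rowP h; apply/eqP/rowP => i.
  by move: (h i); rewrite !mxE => /eqP; rewrite normr_eq0 => /eqP.
split=> //; first by move=> i; rewrite mxE.
pose M := lam%:M - A.
have MT : M^T = M by rewrite /M linearB /= tr_scalar_mx AT.
have psd z : 0 <= mxform M z z by rewrite mxform_subscalar subr_ge0.
have xM : mxform M x x = 0.
  by rewrite /mxform mulmxBr mul_mx_scalar xA subrr mul0mx mxE.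
have yM : mxform M y y = 0.
  apply/eqP; rewrite eq_le psd andbT -xM !mxform_subscalar.
  have -> : mxform 1%:M y y = mxform 1%:M x x.
    by rewrite !mxform1; apply: eq_bigr => i _; rewrite mxE real_normK ?num_real.
  rewrite lerD2l lerN2 !mxformE; apply: ler_sum => i _; apply: ler_sum => j _.
  by rewrite !mxE; apply: ler_wpM2l => //; rewrite -normrM ler_norm.
have yMv v : mxform M y v = 0.
  have := mxform_CauchySchwarz y v MT psd; rewrite yM mul0r => h.
  by apply/eqP; rewrite -sqrf_eq0 eq_le h sqr_ge0.
have : y *m M = 0.
  apply/rowP => j; rewrite [RHS]mxE -(yMv (delta_mx 0 j)) /mxform.
  by rewrite trmx_delta -colE [RHS]mxE.
by rewrite mulmxBr mul_mx_scalar => /eqP; rewrite subr_eq0 => /eqP ->.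
Qed.

End SymmetricForms.

(** * Perron vectors of induced subgraphs *)

Definition nbrs (T : finType) (e : rel T) (B : {set T}) (u : T) : {set T} :=
  [set v in B | e u v].

Section Perron.
Variables (R : realType) (n : nat) (e : rel 'I_n).
Hypotheses (e_sym : symmetric e) (e_irr : irreflexive e).
Implicit Types (B S : {set 'I_n}) (x z : 'I_n -> R) (mu : R).

Definition quad B z : R := \sum_(u in B) \sum_(v in nbrs e B u) z u * z v.

(** The Rayleigh bound in the last clause is what makes [mu] the largest eigenvalue. Entries are
    only nonnegative, since the graph induced on [B] may be disconnected. *)
Definition perron B mu x : Prop :=
  [/\ forall u, 0 <= x u, \sum_(u in B) x u ^+ 2 = 1,
      {in B, forall u, \sum_(v in nbrs e B u) x v = mu * x u}
    & forall z, quad B z <= mu * \sum_(u in B) z u ^+ 2].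

Lemma sum_nbrs B u (F : 'I_n -> R) :
  \sum_(v in nbrs e B u) F v = \sum_(v in B) (e u v)%:R * F v.
Proof.
rewrite [LHS]big_mkcond [RHS]big_mkcond /=; apply: eq_bigr => v _.
by rewrite inE; case: (v \in B) => //=; case: (e u v); rewrite ?mul1r ?mul0r.
Qed.

Lemma quadE B z : quad B z = \sum_(u in B) \sum_(v in B) (e u v)%:R * (z u * z v).
Proof. by apply: eq_bigr => u _; rewrite sum_nbrs. Qed.

Let masked B : 'M[R]_n :=
  \matrix_(i, j) (((i \in B) && (j \in B))%:R * ((e i j)%:R + (i == j)%:R)).

Let masked_form B (z : 'rV[R]_n) :
  mxform (masked B) z z = quad B (z 0) + \sum_(u in B) z 0 u ^+ 2.
Proof.
rewrite mxformE quadE -big_split /= [RHS]big_mkcond; apply: eq_bigr => i _ /=.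
have [iB|iB] := boolP (i \in B); last first.
  by rewrite big1 // => j _; rewrite mxE (negPf iB) !mul0r.
have -> : z 0 i ^+ 2 = \sum_(j in B) (i == j)%:R * (z 0 i * z 0 j).
  rewrite (bigD1 i) //= eqxx mul1r big1 ?addr0 ?expr2 // => j /andP[_ ji].
  by rewrite eq_sym (negPf ji) mul0r.
rewrite -big_split /= [RHS]big_mkcond; apply: eq_bigr => j _ /=.
by rewrite mxE iB /=; case: (j \in B); rewrite ?mul0r // mul1r mulrDl.
Qed.

(* The identity added on [B] keeps the top eigenvalue of the masked matrix
   positive, so that its eigenvectors vanish outside [B]. *)
Lemma perron_exists B : B != set0 -> exists mu x, perron B mu x.
Proof.
case/set0Pn => b bB.
have n0 : (0 < n)%N by apply: leq_ltn_trans (ltn_ord b).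
have mT : (masked B)^T = masked B.
  by apply/matrixP => i j; rewrite !mxE andbC e_sym eq_sym.
have m0 i j : 0 <= masked B i j.
  by rewrite mxE mulr_ge0 ?addr_ge0 ?ler0n.
have [lam [ray [y [y0 yge0 yA]]]] := nonneg_top_eigenvector n0 mT m0.
have rayF z : quad B z + \sum_(u in B) z u ^+ 2 <= lam * \sum_(u in B) z u ^+ 2.
  pose z' : 'rV[R]_n := \row_i (if i \in B then z i else 0).
  have := ray z'; rewrite masked_form mxform1.
  have -> : \sum_i z' 0 i ^+ 2 = \sum_(u in B) z u ^+ 2.
    rewrite [RHS]big_mkcond; apply: eq_bigr => i _; rewrite mxE.
    by case: ifP => // _; rewrite expr0n.
  suff [-> ->] : quad B (z' 0) = quad B z /\
    \sum_(u in B) z' 0 u ^+ 2 = \sum_(u in B) z u ^+ 2 by [].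
  split; last by apply: eq_bigr => i iB; rewrite mxE iB.
  by rewrite !quadE; apply: eq_bigr => i iB; apply: eq_bigr => j jB; rewrite !mxE iB jB.
have lam0 : 0 < lam.
  have := rayF (fun i => (i == b)%:R).
  have -> : \sum_(u in B) (u == b)%:R ^+ 2 = 1 :> R.
    rewrite (bigD1 b) //= eqxx expr1n big1 ?addr0 // => i /andP[_ /negPf->].
    by rewrite expr0n.
  rewrite mulr1; apply: lt_le_trans.
  rewrite ltr_wpDl ?ltr01 //; do 2![apply: sumr_ge0 => ? _].
  by rewrite mulr_ge0 ?ler0n.
have yE j : lam * y 0 j = (j \in B)%:R * (\sum_(v in nbrs e B j) y 0 v + y 0 j).
  transitivity ((y *m masked B) 0 j); first by rewrite yA mxE.
  rewrite mxE; have [jB|jB] := boolP (j \in B); last first.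
    by rewrite mul0r big1 // => i _; rewrite mxE (negPf jB) andbF mul0r mulr0.
  rewrite mul1r sum_nbrs.
  have -> : y 0 j = \sum_(i in B) (i == j)%:R * y 0 i.
    rewrite (bigD1 j) //= eqxx mul1r big1 ?addr0 // => i /andP[_ ji].
    by rewrite (negPf ji) mul0r.
  rewrite -big_split /= [RHS]big_mkcond; apply: eq_bigr => i _ /=.
  rewrite mxE jB andbT e_sym; case: (i \in B); last by rewrite mul0r mulr0.
  by rewrite mul1r -mulrDl mulrC.
have yout j : j \notin B -> y 0 j = 0.
  move=> jB; apply/eqP; have := yE j; rewrite (negPf jB) mul0r => /eqP.
  by rewrite mulf_eq0 (gt_eqF lam0).
have N0 : 0 < \sum_(u in B) y 0 u ^+ 2.
  have := mxform1_gt0 y0; rewrite mxform1 (bigID (mem B)) /=.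
  rewrite [X in _ + X]big1 ?addr0 // => i iB; by rewrite yout // expr0n.
set N := \sum_(u in B) _ in N0.
have sN : 0 < Num.sqrt N by rewrite sqrtr_gt0.
have sNN : Num.sqrt N ^+ 2 = N by rewrite sqr_sqrtr // ltW.
exists (lam - 1), (fun i => y 0 i / Num.sqrt N); split.
- by move=> u; rewrite divr_ge0 // ltW.
- under eq_bigr do rewrite expr_div_n sNN.
  by rewrite -mulr_suml divff // gt_eqF.
- move=> u uB; rewrite -mulr_suml mulrA; congr (_ / _).
  have := yE u; rewrite uB mul1r => h; lra.
- by move=> z; have := rayF z; rewrite mulrBl mul1r lerBrDr.
Qed.

Section Facts.
Variables (B : {set 'I_n}) (mu : R) (x : 'I_n -> R).
Hypothesis pB : perron B mu x.

Lemma quad_perron : quad B x = mu.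
Proof.
have [x0 xn xe _] := pB; rewrite -[RHS]mulr1 -xn mulr_sumr; apply: eq_bigr => u uB.
by rewrite -mulr_sumr xe // expr2; ring.
Qed.

Lemma perron_ge0 : 0 <= mu.
Proof.
have [x0 _ _ _] := pB; rewrite -quad_perron.
by do 2![apply: sumr_ge0 => ? _]; rewrite mulr_ge0.
Qed.

(** By the eigen-equation the rows indexed by [S] contribute [mu x_u^2] each. Removing rows and
    columns subtracts this twice, and the part inside [S] must be given back once. *)
Lemma quad_setD S : S \subset B ->
  quad (B :\: S) x = mu - mu * (\sum_(u in S) x u ^+ 2) *+ 2 + quad S x.
Proof.
move=> SB; have [x0 xn xe _] := pB.
pose f u v : R := (e u v)%:R * (x u * x v).
have split F : \sum_(u in B) F u = \sum_(u in S) F u + \sum_(u in B :\: S) F u :> R.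
  by rewrite (big_setID S) /= (setIidPr SB).
have row u : u \in B -> \sum_(v in B) f u v = mu * x u ^+ 2.
  move=> uB; transitivity (x u * \sum_(v in nbrs e B u) x v).
    by rewrite sum_nbrs mulr_sumr; apply: eq_bigr => v _; rewrite /f; ring.
  by rewrite xe //; ring.
have q1 : mu = \sum_(u in S) \sum_(v in B) f u v + \sum_(u in B :\: S) \sum_(v in B) f u v.
  by rewrite -split -quad_perron quadE.
have q2 : \sum_(u in S) \sum_(v in B) f u v = mu * \sum_(u in S) x u ^+ 2.
  by rewrite mulr_sumr; apply: eq_bigr => u uS; rewrite row // (subsetP SB).
have q3 : \sum_(u in B :\: S) \sum_(v in B) f u v =
   \sum_(v in S) \sum_(u in B :\: S) f u v + quad (B :\: S) x.
  rewrite [X in X + _]exchange_big /= quadE -big_split /=.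
  by apply: eq_bigr => u _; rewrite split.
have q4 : \sum_(u in S) \sum_(v in B) f u v =
    quad S x + \sum_(v in S) \sum_(u in B :\: S) f u v.
  rewrite quadE -big_split /=; apply: eq_bigr => u uS; rewrite split; congr (_ + _).
  by apply: eq_bigr => v _; rewrite /f e_sym [x u * _]mulrC.
lra.
Qed.

Lemma sum_CauchySchwarz S (z : 'I_n -> R) :
  (\sum_(u in S) z u) ^+ 2 <= #|S|%:R * \sum_(u in S) z u ^+ 2.
Proof.
have [->|S0] := eqVneq S set0; first by rewrite !big_set0 expr0n mulr0.
have c0 : 0 < #|S|%:R :> R by rewrite ltr0n card_gt0.
pose m := \sum_(u in S) z u.
have : 0 <= \sum_(u in S) (#|S|%:R * z u - m) ^+ 2.
  by apply: sumr_ge0 => u _; apply: sqr_ge0.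
under eq_bigr do rewrite sqrrB exprMn.
rewrite big_split big_split /= sumrN -mulr_sumr sumr_const sumrMnl.
rewrite -mulr_suml -mulr_sumr -/m -[m ^+ 2 *+ _]mulr_natl => h.
have : 0 <= #|S|%:R * (#|S|%:R * \sum_(i in S) z i ^+ 2 - m ^+ 2).
  by apply: le_trans h _; rewrite le_eqVlt; apply/orP; left; apply/eqP; ring.
by rewrite pmulr_rge0 // subr_ge0.
Qed.

(** The form on [B :\: S] is nonnegative, while inside [S] it is at most [|S| - 1] times the mass.
    For a single vertex this says that no squared entry exceeds 1/2. *)
Lemma perron_mass S : S \subset B ->
  mu * (\sum_(u in S) x u ^+ 2) *+ 2 <= mu + (#|S|%:R - 1) * \sum_(u in S) x u ^+ 2.
Proof.
move=> SB; have [x0 xn xe _] := pB; have := quad_setD SB.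
have : 0 <= quad (B :\: S) x by do 2![apply: sumr_ge0 => ? _]; rewrite mulr_ge0.
suff : quad S x <= (#|S|%:R - 1) * \sum_(u in S) x u ^+ 2 by lra.
apply: le_trans (_ : (\sum_(u in S) x u) ^+ 2 - \sum_(u in S) x u ^+ 2 <= _); last first.
  by rewrite mulrBl mul1r lerD2r sum_CauchySchwarz.
rewrite expr2 mulr_suml quadE lerBrDr -big_split /=; apply: ler_sum => u uS.
rewrite mulr_sumr [leLHS]addrC (bigD1 u) //= e_irr mul0r add0r [leRHS](bigD1 u) //=.
rewrite expr2 lerD2l; apply: ler_sum => v _.
by case: (e u v); rewrite ?mul1r ?mul0r ?mulr_ge0.
Qed.

(** The restriction of [x] serves as test vector for the smaller graph. *)
Lemma perron_delete u mu' x' : u \in B -> perron (B :\ u) mu' x' ->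
  mu * (1 - x u ^+ 2 *+ 2) <= mu' * (1 - x u ^+ 2).
Proof.
move=> uB [_ _ _ ray]; have [x0 xn xe _] := pB.
have uS : [set u] \subset B by rewrite sub1set.
have := ray x; rewrite quad_setD //.
have -> : \sum_(v in B :\ u) x v ^+ 2 = 1 - x u ^+ 2.
  by rewrite -xn [in RHS](big_setD1 u) //= [RHS]addrC addKr.
have -> : quad [set u] x = 0 by rewrite quadE !big_set1 e_irr mul0r.
by rewrite big_set1 addr0; apply: le_trans; rewrite le_eqVlt; apply/orP; left; apply/eqP; ring.
Qed.

Lemma perron_half u : u \in B -> 0 < mu -> x u ^+ 2 *+ 2 <= 1.
Proof.
move=> uB mu0; have := @perron_mass [set u]; rewrite sub1set uB cards1 big_set1.
rewrite subrr mul0r addr0 => /(_ isT).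
by rewrite -mulrnAr -[X in _ <= X -> _]mulr1 ler_pM2l.
Qed.

(** Cauchy-Schwarz on the eigen-equation at [u]: every vertex of [B] that is not a neighbour keeps
    mass [bet] away from the neighbourhood. *)
Lemma perron_degree u bet : u \in B ->
  {in B, forall v, bet <= x v ^+ 2} ->
  mu ^+ 2 * bet <= #|nbrs e B u|%:R * (1 - (#|B|%:R - #|nbrs e B u|%:R) * bet).
Proof.
move=> uB hb; have [x0 xn xe _] := pB.
apply: le_trans (_ : (mu * x u) ^+ 2 <= _).
  by rewrite exprMn; apply: ler_wpM2l; rewrite ?sqr_ge0 ?hb.
rewrite -xe //; apply: le_trans (sum_CauchySchwarz _ _) _; apply: ler_wpM2l => //.
have NB : nbrs e B u \subset B by apply/subsetP => v; rewrite inE => /andP[].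
rewrite -natrB ?subset_leq_card // lerBrDr.
apply: le_trans (_ : _ <= \sum_(v in B) x v ^+ 2) _; last by rewrite xn.
rewrite [leRHS](big_setID (nbrs e B u)) /= (setIidPr NB) lerD2l.
rewrite -{1}(setIidPr NB) -cardsD mulr_natl -sumr_const.
apply: ler_sum => v /setDP[vB _]; exact: hb.
Qed.

(** On a set closed under adjacency the restriction of [x] still satisfies the eigen-equation for
    [mu], and it is nonzero there. *)
Lemma perron_closed S mu' x' : S \subset B -> (exists2 u, u \in S & 0 < x u) ->
  {in S, forall u, nbrs e B u \subset S} -> perron S mu' x' -> mu <= mu'.
Proof.
move=> SB [u uS xu] cl [_ _ _ ray]; have [x0 xn xe _] := pB.
have S0 : 0 < \sum_(u in S) x u ^+ 2.
  rewrite (bigD1 u) //= ltr_wpDr // ?exprn_gt0 //.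
  by apply: sumr_ge0 => v _; apply: sqr_ge0.
rewrite -(ler_pM2r S0); apply: le_trans (ray x).
rewrite mulr_sumr; apply: ler_sum => v vS.
have -> : nbrs e S v = nbrs e B v.
  apply/setP => w; rewrite !inE; case: (boolP (w \in S)) => wS.
    by rewrite (subsetP SB).
  apply/esym/negbTE; apply: contra wS => h; apply: (subsetP (cl v vS)); by rewrite inE.
by rewrite -mulr_sumr xe ?(subsetP SB) // expr2 mulrCA.
Qed.

Lemma perron_max_degree d : (0 < mu) -> {in B, forall u, (#|nbrs e B u| <= d)%N} -> mu <= d%:R.
Proof.
move=> mu0 hd; have [x0 xn xe _] := pB.
have -> : d%:R = d%:R * \sum_(u in B) x u ^+ 2 by rewrite xn mulr1.
rewrite -quad_perron quadE.
apply: le_trans (_ : \sum_(u in B) \sum_(v in B) (e u v)%:R * ((x u ^+ 2 + x v ^+ 2) / 2%:R) <= _).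
  apply: ler_sum => u _; apply: ler_sum => v _; apply: ler_wpM2l; rewrite ?ler0n //.
  have := sqr_ge0 (x u - x v); nra.
have h : \sum_(u in B) \sum_(v in B) (e u v)%:R * x u ^+ 2 <= d%:R * \sum_(u in B) x u ^+ 2.
  rewrite mulr_sumr; apply: ler_sum => u uB; rewrite -mulr_suml.
  apply: ler_wpM2r; rewrite ?sqr_ge0 //.
  have := sum_nbrs B u (fun=> 1); rewrite sumr_const => h.
  under eq_bigr do rewrite -[_%:R]mulr1.
  by rewrite -h ler_nat hd.
have h' : \sum_(u in B) \sum_(v in B) (e u v)%:R * x v ^+ 2 =
    \sum_(u in B) \sum_(v in B) (e u v)%:R * x u ^+ 2.
  by rewrite exchange_big /=; apply: eq_bigr => u _; apply: eq_bigr => v _; rewrite e_sym.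
under eq_bigr do under eq_bigr do rewrite mulrA mulrDr mulrDl.
under eq_bigr do rewrite big_split /=.
rewrite big_split /=; under eq_bigr do rewrite -mulr_suml.
under [X in _ + X]eq_bigr do rewrite -mulr_suml.
rewrite -!mulr_suml h'; lra.
Qed.

End Facts.
End Perron.

(** * Longest paths and what lies outside them *)

Local Open Scope nat_scope.

Lemma ex_longest_seq (T : finType) (P : pred (seq T)) N :
  (forall s, P s -> size s <= N) -> (exists s, P s) ->
  exists2 s, P s & forall s', P s' -> size s' <= size s.
Proof.
move=> ub [s0 Ps0].
pose Q m := [exists t : m.-tuple T, P t].
have exQ : exists m, Q m by exists (size s0); apply/existsP; exists (in_tuple s0).
have ubQ m : Q m -> m <= N by case/existsP => t /ub; rewrite size_tuple.
case: (ex_maxnP exQ ubQ) => m /existsP[t Pt] mmax; exists t => // s' Ps'.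
by rewrite size_tuple; apply: mmax; apply/existsP; exists (in_tuple s').
Qed.

(** Cut the window into [D] pairs of consecutive integers. A set without consecutive elements meets
    each pair at most once, so [D] elements force exactly one per pair. *)
Lemma sparse_set_pairs l (X : {set 'I_l}) a D :
  {in X, forall i : 'I_l, a <= i < a + D.*2} ->
  {in X &, forall i j : 'I_l, (j : nat) != i.+1} ->
  #|X| <= D /\
  (D <= #|X| -> forall m, m < D ->
     exists2 i, i \in X & (i : nat) = a + m.*2 \/ (i : nat) = (a + m.*2).+1).
Proof.
case: D => [|D] hX sp.
  have -> : X = set0.
    apply/setP => i; rewrite inE; apply/negbTE/negP => /hX; lia.
  by rewrite cards0.
pose f (i : 'I_l) : 'I_D.+1 := inord (i - a)./2.
have fE i : i \in X -> f i = (i - a)./2 :> nat.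
  by move=> iX; rewrite inordK //; have := hX _ iX; lia.
have finj : {in X &, injective f}.
  move=> i j iX jX /(congr1 val) /=; rewrite !fE // => h; apply: val_inj => /=.
  have := sp _ _ iX jX; have := sp _ _ jX iX; have := hX _ iX; have := hX _ jX; lia.
have c : #|f @: X| = #|X| by apply: card_in_imset.
split; first by rewrite -c; have := max_card (mem (f @: X)); rewrite card_ord.
move=> Dle m mD.
have fT : f @: X = setT.
  by apply/eqP; rewrite eqEcard subsetT cardsT card_ord c.
have : inord m \in f @: X by rewrite fT inE.
case/imsetP => i iX /(congr1 val) /=; rewrite inordK // fE // => h.
by exists i => //; have := hX _ iX; lia.
Qed.

Section Paths.
Variables (T : finType) (e : rel T) (x0 : T).
Hypotheses (e_sym : symmetric e) (e_irr : irreflexive e).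
Implicit Types (B O : {set T}) (p q s t : seq T) (u v w : T).

Definition upath B p : bool := [&& uniq p, sorted e p & all [in B] p].

Lemma upath_rev B p : upath B (rev p) = upath B p.
Proof.
rewrite /upath rev_uniq all_rev rev_sorted.
by rewrite (@eq_sorted _ (fun y x => e x y) e) // => y x; rewrite e_sym.
Qed.

Lemma upath_sub B O p : B \subset O -> upath B p -> upath O p.
Proof.
move=> BO /and3P[up sp /allP ap]; rewrite /upath up sp /=.
by apply/allP => u /ap; apply: (subsetP BO).
Qed.

Lemma sorted_cat s t : sorted e s -> sorted e t ->
  (s != [::] -> t != [::] -> e (last x0 s) (head x0 t)) -> sorted e (s ++ t).
Proof.
case: s => [//|a s] /= ps; case: t => [|b t] /=; first by rewrite cats0.
by move=> pt h; rewrite cat_path ps /= pt h.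
Qed.

Lemma upath_cat B s t : upath B s -> upath B t -> ~~ has [in s] t ->
  (s != [::] -> t != [::] -> e (last x0 s) (head x0 t)) -> upath B (s ++ t).
Proof.
move=> /and3P[us ss aS] /and3P[ut st aT] hst j.
by rewrite /upath cat_uniq us ut hst sorted_cat // all_cat aS aT.
Qed.

Lemma head_in q : q != [::] -> head x0 q \in q.
Proof. by case: q => //= a q _; rewrite mem_head. Qed.

Lemma last_in q : q != [::] -> last x0 q \in q.
Proof. by case: q => //= a q _; rewrite mem_last. Qed.

Lemma head_rev q : head x0 (rev q) = last x0 q.
Proof. by elim/last_ind: q => // q a _; rewrite rev_rcons last_rcons. Qed.

Lemma last_rev q : last x0 (rev q) = head x0 q.
Proof. by rewrite -[in RHS](revK q) head_rev. Qed.

Section Longest.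
Variables (B : {set T}) (p : seq T) (k : nat).
Hypotheses (pB : upath B p)
  (pmax : forall p', upath B p' -> size p' <= size p)
  (pk : size p <= 2 * k + 2).
Notation v i := (nth x0 p i).
Notation l := (size p).
Definition off := B :\: [set u in p].

(** Replacing the positions from [i] up to but excluding [j] by [q] gives another path in [B], no
    longer than [p]. At either end of [p] the corresponding adjacency is void. *)
Lemma insert_path q i j : upath off q -> q != [::] -> i <= j <= l ->
  (0 < i -> e (v i.-1) (head x0 q)) -> (j < l -> e (last x0 q) (v j)) ->
  size q <= j - i.
Proof.
move=> uq q0 /andP[ij jl] hi hj.
have [up sp ap] := and3P pB.
have ut : upath B (take i p).
  rewrite /upath take_uniq // take_sorted //=.
  by apply/allP => u /mem_take; apply: (allP ap).
have ud : upath B (drop j p).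
  rewrite /upath drop_uniq // drop_sorted //=.
  by apply/allP => u /mem_drop; apply: (allP ap).
have uqB : upath B q by apply: upath_sub uq; apply: subsetDl.
have qp u : u \in q -> u \notin p.
  by case/and3P: uq => _ _ /allP h /h; rewrite /off !inE => /andP[].
have u1 : upath B (q ++ drop j p).
  apply: upath_cat => //.
    by apply/hasPn => u /mem_drop up'; apply/negP => /qp; rewrite up'.
  move=> _; rewrite -size_eq0 size_drop -lt0n subn_gt0 => jl'.
  by rewrite -nth0 nth_drop addn0 hj.
have u2 : upath B (take i p ++ (q ++ drop j p)).
  apply: upath_cat => //.
    apply/hasPn => u; rewrite mem_cat => /orP[/qp|ud'].
      by apply: contraNN => /mem_take.
    apply/negP => ut'.
    have : take j p ++ drop j p == p by rewrite cat_take_drop.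
    move/eqP => pE; move: up; rewrite -pE cat_uniq => /and3P[_ /hasPn /(_ u ud') h _].
    case/negP: h => /=.
    have -> : take j p = take i p ++ drop i (take j p).
      by rewrite -{1}(cat_take_drop i (take j p)) take_takel.
    by rewrite mem_cat ut'.
  rewrite -size_eq0 size_take_min -lt0n => h _.
  have i0 : 0 < i by case: (i) h => //; rewrite min0n.
  have il : i.-1 < l by rewrite prednK // (leq_trans ij jl).
  have -> : head x0 (q ++ drop j p) = head x0 q by case: (q) q0.
  have -> : last x0 (take i p) = v i.-1.
    by rewrite -nth_last size_take_min (minn_idPl _) ?nth_take ?prednK // (leq_trans ij jl).
  exact: hi.
have := pmax u2; rewrite !size_cat size_take_min size_drop.
move: ij jl; clear; lia.
Qed.

(** [rev q] may replace everything before position [i], and [q] everything after it. *)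
Lemma end_position q i : upath off q -> q != [::] -> i < l ->
  e (v i) (head x0 q) -> size q <= i /\ i + size q < l.
Proof.
move=> uq q0 il ei; split.
  have := @insert_path (rev q) 0 i; rewrite upath_rev size_rev subn0; apply=> //.
  - by rewrite -size_eq0 size_rev size_eq0.
  - by rewrite (ltnW il).
  - by move=> _; rewrite last_rev e_sym.
have := @insert_path q i.+1 l uq q0; rewrite il leqnn ltnn.
move=> /(_ isT (fun=> ei) (fun h => False_ind _ (notF h))); lia.
Qed.

Lemma off_nonconsecutive w i : w \in off -> i.+1 < l -> e (v i) w -> ~~ e (v i.+1) w.
Proof.
move=> wO il ei; apply/negP => ei1.
have uw : upath off [:: w] by rewrite /upath /= wO.
have := @insert_path [:: w] i.+1 i.+1 uw isT; rewrite leqnn (ltnW il) /=.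
by move=> /(_ isT (fun=> ei)); rewrite e_sym ei1 subnn => /(_ (fun=> isT)).
Qed.

Definition pos w : {set 'I_l} := [set i : 'I_l | e (v i) w].

Lemma pos_sparse w : w \in off -> {in pos w &, forall i j : 'I_l, (j : nat) != i.+1}.
Proof.
move=> wO i j; rewrite !inE => ei ej; apply/negP => /eqP ji.
have := @off_nonconsecutive w i wO; rewrite -ji ltn_ord ej => /(_ isT ei); by [].
Qed.

Lemma card_on_path w : #|[set u in p | e u w]| <= #|pos w|.
Proof.
apply: leq_trans (leq_imset_card (fun i : 'I_l => v i) (pos w)).
apply: subset_leq_card; apply/subsetP => u; rewrite inE => /andP[up eu].
have h : index u p < l by rewrite index_mem.
by apply/imsetP; exists (Ordinal h); rewrite ?inE /= nth_index.
Qed.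

Definition rooted q := [&& upath off q, q != [::] & has (fun u => e u (head x0 q)) p].

Lemma rootedP q : rooted q ->
  [/\ upath off q, q != [::] & exists2 i, i < l & e (v i) (head x0 q)].
Proof.
case/and3P => uq q0 /hasP[u up eu]; split=> //; exists (index u p).
  by rewrite index_mem.
by rewrite nth_index.
Qed.

Lemma rooted_size q : rooted q -> size q <= k.
Proof. case/rootedP => uq q0 [i il /(end_position uq q0 il)]; lia. Qed.

Section MaximalRooted.
Variables (s d : nat).
Hypotheses (smax : forall q, rooted q -> size q <= s)
  (degB : {in B, forall w, d <= #|nbrs e B w|}).

Lemma last_in_off q : rooted q -> last x0 q \in off.
Proof. by case/rootedP => /and3P[_ _ /allP h] q0 _; apply: h; apply: last_in. Qed.

(** Any other neighbour of the last vertex would extend [q] to a longer rooted path. *)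
Lemma last_nbrs q : rooted q -> size q = s ->
  nbrs e B (last x0 q) \subset
    [set u in q] :\ last x0 q :|: [set u in p | e u (last x0 q)].
Proof.
move=> rq sq; have [uq q0 _] := rootedP rq; set z := last x0 q.
apply/subsetP => u; rewrite !inE => /andP[uB ez].
have [up|up] := boolP (u \in p); first by rewrite /= e_sym ez orbT.
rewrite orbF; apply/andP; split; first by apply: contraTneq ez => ->; rewrite e_irr.
apply/negPn/negP => uq'.
have : rooted (rcons q u).
  case/and3P: rq => _ _ hr; apply/and3P; split.
  - rewrite -cats1; apply: upath_cat => //=.
    + by rewrite /upath /= !inE up uB.
    + by rewrite orbF.
  - by rewrite -size_eq0 size_rcons.
  - by have -> : head x0 (rcons q u) = head x0 q by case: (q) q0.
by move/smax; rewrite size_rcons sq ltnn.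
Qed.

Lemma card_body q : rooted q -> size q = s -> #|[set u in q] :\ last x0 q| = s.-1.
Proof.
move=> rq sq; have [/and3P[uq _ _] q0 _] := rootedP rq.
have := cardsD1 (last x0 q) [set u in q]; rewrite inE last_in // cardsE.
rewrite (card_uniqP uq) sq; lia.
Qed.

Lemma last_degree q : rooted q -> size q = s -> d <= s.-1 + #|pos (last x0 q)|.
Proof.
move=> rq sq.
have zB : last x0 q \in B by have := last_in_off rq; rewrite inE => /andP[].
apply: leq_trans (degB zB) _.
apply: leq_trans (subset_leq_card (last_nbrs rq sq)) _.
apply: leq_trans (leq_card_setU _ _) _.
by rewrite card_body // leq_add2l card_on_path.
Qed.

(** A neighbour at position [i] has at least [s] vertices of [p] on each side; since
    [size p <= 2k+2], this leaves a window of [2(k-s+1)] positions. *)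
Lemma pos_last_window q : rooted q -> size q = s ->
  {in pos (last x0 q), forall i : 'I_l, s <= i < s + (k - s).+1.*2}.
Proof.
move=> rq sq i; rewrite inE => ei; have [uq q0 _] := rootedP rq.
have := @end_position (rev q) i; rewrite upath_rev size_rev head_rev.
move=> /(_ uq); rewrite -size_eq0 size_rev size_eq0 => /(_ q0 (ltn_ord i) ei).
have := rooted_size rq; lia.
Qed.

(** The last vertex of [q] has at most [s-1] neighbours on [q] and at most one in each of the
    [k-s+1] pairs of its window. *)
Lemma rooted_min_degree q : rooted q -> size q = s -> d <= k.
Proof.
move=> rq sq; have := last_degree rq sq.
have [h _] := sparse_set_pairs (pos_last_window rq sq) (pos_sparse (last_in_off rq)).
have := rooted_size rq; have [_ q0 _] := rootedP rq.
have : 0 < size q by case: (q) q0.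
lia.
Qed.

Hypothesis dk : d = k.

(** Degree [k] exceeds the [s-1 < k] neighbours available on [q], so the other end also sees [p]. *)
Lemma rooted_rev q : rooted q -> size q = s -> rooted (rev q).
Proof.
move=> rq sq; have [uq q0 _] := rootedP rq; apply/and3P; split.
- by rewrite upath_rev.
- by rewrite -size_eq0 size_rev size_eq0.
rewrite head_rev; have := last_degree rq sq; have := rooted_size rq => h1 h2.
have s0 : 0 < size q by case: (q) q0.
have : 0 < #|pos (last x0 q)| by lia.
rewrite card_gt0 => /set0Pn[i]; rewrite inE => ei.
by apply/hasP; exists (v i) => //; apply: mem_nth.
Qed.

(** With minimum degree exactly [k] the count behind [rooted_min_degree] is tight, so every pair of
    the window is hit. *)
Lemma pos_last_pairs q m : rooted q -> size q = s -> m <= k - s ->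
  exists2 i, i \in pos (last x0 q) &
    (i : nat) = s + m.*2 \/ (i : nat) = (s + m.*2).+1.
Proof.
move=> rq sq mk.
have [_ h] := sparse_set_pairs (pos_last_window rq sq) (pos_sparse (last_in_off rq)).
apply: h => //; have := last_degree rq sq; have := rooted_size rq.
have [_ q0 _] := rootedP rq; have : 0 < size q by case: (q) q0.
lia.
Qed.

(** Otherwise [q] would fit strictly between the two positions and lengthen [p]. *)
Lemma ends_distance q i j : rooted q -> size q = s ->
  i \in pos (head x0 q) -> j \in pos (last x0 q) -> (i != j :> nat) ->
  s < j - i \/ s < i - j.
Proof.
move=> rq sq; rewrite !inE => ei ej ij; have [uq q0 _] := rootedP rq.
have [lt|lt] : i < j \/ j < i by lia.
- left; have := @insert_path q i.+1 j uq q0; rewrite lt (ltnW (ltn_ord j)) => h.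
  have := h isT (fun=> ei); rewrite e_sym => /(_ (fun=> ej)); lia.
- right; have := @insert_path (rev q) j.+1 i; rewrite upath_rev uq lt (ltnW (ltn_ord i)).
  rewrite -size_eq0 size_rev size_eq0 head_rev last_rev e_sym => h.
  have := h isT q0 isT; rewrite /= e_sym => /(_ (fun=> ej)); rewrite e_sym => /(_ (fun=> ei)).
  lia.
Qed.

(** Both ends of [q] hit every pair of the same window, yet distinct positions for the two ends must
    differ by more than [s]. The two requirements are compatible only if the positions coincide, and
    then only for the listed values of [s]. *)
Lemma pos_head_last q : rooted q -> size q = s -> 1 < s ->
  pos (head x0 q) = pos (last x0 q) /\ #|pos (last x0 q)| = (k - s).+1 /\
  (s = k \/ (k = 3 /\ s = 2)).
Proof.
move=> rq sq s1; have rq' := rooted_rev rq sq.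
have sq' : size (rev q) = s by rewrite size_rev.
have sk := rooted_size rq; rewrite sq in sk.
have pa := pos_last_pairs rq sq; have pb := pos_last_pairs rq' sq'.
have wa := pos_last_window rq sq; have wb := pos_last_window rq' sq'.
have na := pos_sparse (last_in_off rq); have nb := pos_sparse (last_in_off rq').
rewrite last_rev in pb wb nb.
have ds i j := @ends_distance q i j rq sq.
have [cl _] := sparse_set_pairs wa na.
have cc : #|pos (last x0 q)| = (k - s).+1.
  by have := last_degree rq sq; lia.
(* If there is a second pair, the head's position in pair 1 and the last vertex's in pair 0 are at
   distance 1 to 3, which must exceed [s >= 2]: hence [s = 2] and the head sits at [s + 3]. A third
   pair would put a neighbour of the last vertex within distance 2 of it. *)
have cs : s = k \/ (k = 3 /\ s = 2).
  have [->|ks] := eqVneq s k; [by left | right].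
  have k1 : 1 <= k - s by rewrite subn_gt0 ltn_neqAle ks.
  have [j0 j0P j0E] := pa 0 isT; have [i1 i1P i1E] := pb 1 k1.
  have d10 := ds _ _ i1P j0P.
  have i1s : (i1 : nat) = s + 3 /\ s = 2.
    by move: d10 j0E i1E s1; clear; lia.
  have [k2|k2] := leqP 2 (k - s); last by move: i1s k1 k2; clear; lia.
  have [j2 j2P j2E] := pa 2 k2; have d12 := ds _ _ i1P j2P.
  by move: i1s d12 j2E; clear; lia.
split=> //.
(* Positions of the two ends in a common pair differ by at most one, hence agree. *)
have key i j : i \in pos (head x0 q) -> j \in pos (last x0 q) ->
    (i : nat) <= j.+1 -> (j : nat) <= i.+1 -> i = j.
  move=> iP jP h1 h2; apply: val_inj => /=; apply/eqP/negPn/negP => ij.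
  by have := ds _ _ iP jP ij; move: ij h1 h2 s1; clear; lia.
apply/setP => i; apply/idP/idP => iP.
  have := wb _ iP; set m := (i - s)./2 => hi.
  have [j jP jE] : exists2 j, j \in pos (last x0 q) &
      (j : nat) = s + m.*2 \/ (j : nat) = (s + m.*2).+1.
    by apply: pa; move: hi; rewrite /m; clear; lia.
  by rewrite (key i j) //; move: hi jE; rewrite /m; clear; lia.
have := wa _ iP; set m := (i - s)./2 => hi.
have [j jP jE] : exists2 j, j \in pos (head x0 q) &
      (j : nat) = s + m.*2 \/ (j : nat) = (s + m.*2).+1.
  by apply: pb; move: hi; rewrite /m; clear; lia.
by rewrite -(key j i) //; move: hi jE; rewrite /m; clear; lia.
Qed.

(** The degree count is tight, so the last vertex is adjacent to all other vertices of [q], and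
    [1 < s] makes the head one of them. *)
Lemma last_head_adj q : rooted q -> size q = s -> 1 < s -> e (last x0 q) (head x0 q).
Proof.
move=> rq sq s1; have [uq q0 _] := rootedP rq.
have [_ [cp _]] := pos_head_last rq sq s1.
have sk := rooted_size rq; rewrite sq in sk.
have zB : last x0 q \in B by have := last_in_off rq; rewrite inE => /andP[].
have : nbrs e B (last x0 q) ==
    [set u in q] :\ last x0 q :|: [set u in p | e u (last x0 q)].
  rewrite eqEcard last_nbrs //=; apply: leq_trans (degB zB).
  apply: leq_trans (leq_card_setU _ _) _; rewrite card_body //.
  have := card_on_path (last x0 q); rewrite cp dk.
  by move: (#|_|) sk s1 => c; clear; lia.
move/eqP/setP/(_ (head x0 q)); rewrite !inE head_in //.
have -> : head x0 q != last x0 q.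
  case/and3P: uq => + _ _; case: (q) sq => [|a [|b t]] /=; rewrite -?sq //=; try lia.
  by move=> _ /andP[h _]; apply: contraNneq h => ->; rewrite mem_last.
by move=> /= /andP[].
Qed.

(** Closing [q] into a cycle allows a rotation. The reversed rotation starts at the old head, hence
    is rooted, and equality of positions at its two ends carries the positions along. *)
Lemma rooted_rot1 q : rooted q -> size q = s -> 1 < s ->
  rooted (rot 1 q) /\ pos (head x0 (rot 1 q)) = pos (head x0 q).
Proof.
move=> rq sq s1; have lh := last_head_adj rq sq s1.
have [uq q0 _] := rootedP rq.
have r1 : rooted (rev (rot 1 q)).
  apply/and3P; split.
  - rewrite upath_rev; case/and3P: uq => uu su au; apply/and3P; split.
    + by rewrite rot_uniq.
    + case: (q) su lh => [//|a t] /=; rewrite rot1_cons.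
      by case: t => [//|b t] /= /andP[_ pt] lh; rewrite rcons_path pt.
    + by apply/allP => u; rewrite mem_rot; apply: (allP au).
  - by rewrite -size_eq0 size_rev size_rot size_eq0.
  - have -> : head x0 (rev (rot 1 q)) = head x0 q.
      by rewrite head_rev; case: (q) => [//|a t]; rewrite rot1_cons last_rcons.
    by case/and3P: rq.
have s1' : size (rev (rot 1 q)) = s by rewrite size_rev size_rot.
have r2 := rooted_rev r1 s1'; rewrite revK in r2; split=> //.
have s2 : size (rot 1 q) = s by rewrite size_rot.
have [-> _] := pos_head_last r2 s2 s1.
by congr pos; case: (q) q0 => [//|a t] _; rewrite rot1_cons last_rcons.
Qed.

Lemma rooted_rot q j : rooted q -> size q = s -> 1 < s -> j <= s ->
  rooted (rot j q) /\ pos (head x0 (rot j q)) = pos (head x0 q).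
Proof.
move=> rq sq s1; elim: j => [|j IH] js; first by rewrite rot0.
have [rj pj] := IH (ltnW js); rewrite rotS ?sq //.
by have [? ->] := rooted_rot1 rj (etrans (size_rot _ _) sq) s1.
Qed.

(** Rotation brings any vertex of [q] to an end, so all of them see the same [k-s+1] positions of
    [p] and otherwise only [q]. *)
Lemma rooted_cluster q : rooted q -> size q = s -> 1 < s ->
  exists Q N : {set T}, [/\ Q \subset B, N \subset B, #|Q| = s, #|N| <= (k - s).+1 &
    {in Q, forall u, nbrs e B u \subset Q :|: N}].
Proof.
move=> rq sq s1; have [uq q0 _] := rootedP rq.
have [pE [cp _]] := pos_head_last rq sq s1.
have [up _ /allP pS] := and3P pB; have [uu _ /allP qS] := and3P uq.
exists [set u in q], [set v (i : 'I_l) | i in pos (head x0 q)]; split.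
- by apply/subsetP => u; rewrite inE => /qS; rewrite inE => /andP[].
- by apply/subsetP => _ /imsetP[i _ ->]; apply: pS; apply: mem_nth.
- by rewrite cardsE (card_uniqP uu).
- by rewrite -cp -pE; apply: leq_imset_card.
move=> u; rewrite inE => uq'.
have iu : index u q <= s by rewrite -sq index_size.
have [rj pj] := rooted_rot rq sq s1 iu.
have sj : size (rot (index u q) q) = s by rewrite size_rot.
have hu : head x0 (rot (index u q) q) = u by rewrite rot_index.
have rv := rooted_rev rj sj.
have := last_nbrs rv (etrans (size_rev _) sj); rewrite last_rev hu => h.
apply: subset_trans h _; apply/subsetP => w.
rewrite in_setU in_setD1 [X in _ && X]inE mem_rev mem_rot [X in _ || X]inE in_setU inE.
case/orP => [/andP[_ ->] //|/andP[wp ew]].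
apply/orP; right; have iw : index w p < l by rewrite index_mem.
apply/imsetP; exists (Ordinal iw); last by rewrite nth_index.
by rewrite -pj hu inE nth_index.
Qed.

End MaximalRooted.
Hypothesis connB : forall S : {set T}, S \subset B -> S != set0 ->
  {in S, forall u, nbrs e B u \subset S} -> S = B.

Lemma ex_longest_rooted : B != set0 -> off != set0 ->
  exists2 q, rooted q & forall q', rooted q' -> size q' <= size q.
Proof.
move=> B0 O0; apply: (@ex_longest_seq _ rooted k) => [q|]; first exact: rooted_size.
case: (pickP (fun w => (w \in off) && has (fun u => e u w) p)) => [w /andP[wO hw]|no].
  by exists [:: w]; rewrite /rooted /upath /= wO hw.
have pS : [set u in p] \subset B.
  by apply/subsetP => u; rewrite inE; case/and3P: pB => _ _ /allP h /h.
have /(connB pS) h : [set u in p] != set0.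
  case/set0Pn: B0 => b bB; apply/set0Pn.
  have ub : upath B [:: b] by rewrite /upath /= bB.
  have := pmax ub => /=; case: (p) => // a t _; by exists a; rewrite inE mem_head.
suff : off == set0 by rewrite (negPf O0).
rewrite /off h ?setDv // => u; rewrite inE => up; apply/subsetP => w.
rewrite !inE => /andP[wB euw]; apply/negPn/negP => wp.
have := no w; rewrite !inE wp wB /= => /hasP[]; by exists u.
Qed.

(** If no edge off [p] starts next to [p], then [p] together with the vertices next to it is closed,
    hence is all of [B] by connectivity; so [w] itself is next to [p]. *)
Lemma rooted_edge w w' : w \in off -> w' \in off -> e w w' ->
  exists2 q, rooted q & 1 < size q.
Proof.
move=> wO wO' eww.
have mk u u' : u \in off -> u' \in off -> e u u' -> has (fun a => e a u) p ->
    exists2 q, rooted q & 1 < size q.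
  move=> uO uO' euu hu; exists [:: u; u'] => //.
  rewrite /rooted /upath /= uO uO' euu hu !andbT inE; apply: contraTneq euu => ->.
  by rewrite e_irr.
pose S := [set u in p] :|: [set u in off | has (fun a => e a u) p].
have [/existsP[u /existsP[u' /and4P[]]]|] :=
  boolP [exists u, exists u', [&& u \in off, u' \in off, e u u' & has (fun a => e a u) p]].
  exact: mk.
move=> no.
have pS : [set u in p] \subset B.
  by apply/subsetP => u; rewrite inE; case/and3P: pB => _ _ /allP h /h.
have SB : S = B.
  apply: connB.
  - by rewrite subUset pS; apply/subsetP => u; rewrite !inE => /andP[/andP[]].
  - have wB : w \in B by move: wO; rewrite inE => /andP[].
    have ub : upath B [:: w] by rewrite /upath /= wB.
    apply/set0Pn; have := pmax ub => /=; rewrite /S; case: (p) => // a t _.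
    by exists a; rewrite !inE eqxx.
  move=> u uS; apply/subsetP => x; rewrite [x \in nbrs _ _ _]inE => /andP[xB eux].
  have [xp|xp] := boolP (x \in p); first by rewrite !inE xp.
  have xO : x \in off by rewrite !inE xp.
  rewrite /S in_setU [X in _ || X]inE xO /=; apply/orP; right.
  move: uS; rewrite /S in_setU => /orP[|].
    by rewrite inE => up; apply/hasP; exists u.
  rewrite inE => /andP[uO hu].
  case/negP: no; apply/existsP; exists u; apply/existsP; exists x.
  by rewrite uO xO eux hu.
have : w \in S by rewrite SB; move: wO; rewrite inE => /andP[].
have wp : w \notin p by move: wO; rewrite !inE => /andP[].
by case/setUP; rewrite inE ?(negPf wp) // => /andP[_]; apply: (mk w w').
Qed.

(** Here [s = 1]: each vertex off [p] has one neighbour in each of the [k] pairs of positions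
    [2m+1, 2m+2]. An upper choice in one pair excludes the lower choice in the next, so a pattern is
    lower choices followed by upper ones: [k+1] patterns. *)
Lemma ex_common_nbrs : {in B, forall w, k <= #|nbrs e B w|} -> 0 < k ->
  off != set0 -> (forall q, rooted q -> size q <= 1) ->
  exists K M : {set T}, [/\ K \subset B, #|K| = k, #|off| <= k.+1 * #|M| &
    {in K & M, forall u w, e u w}].
Proof.
move=> degB k0 O0 smax.
have noedge w w' : w \in off -> w' \in off -> ~~ e w w'.
  by move=> wO wO'; apply/negP => /(rooted_edge wO wO') [q /smax]; case: ltngtP.
have root1 w : w \in off -> rooted [:: w].
  move=> wO; have wB : w \in B by move: wO; rewrite inE => /andP[].
  rewrite /rooted /upath /= wO /=; have := leq_trans k0 (degB w wB).
  rewrite card_gt0 => /set0Pn[u]; rewrite inE => /andP[uB ewu].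
  apply/hasP; exists u; last by rewrite e_sym.
  by apply: contraTT ewu => up; apply: noedge => //; rewrite !inE up.
have pairs w m : w \in off -> m < k -> exists2 i : 'I_l, e (v i) w &
    (i : nat) = m.*2.+1 \/ (i : nat) = m.*2.+2.
  move=> wO mk; have [|i] := @pos_last_pairs 1 k smax degB erefl [:: w] m (root1 _ wO) erefl.
    by lia.
  by rewrite inE => ei iE; exists i.
(* The first pair with an upper choice, or [k] if there is none. The test [m.*2.+2 < l] keeps the
   default value of [nth] from being taken for a neighbour. *)
pose c w := find (fun m => e (v m.*2.+2) w && (m.*2.+2 < l)) (iota 0 k).
have ck w : c w < k.+1 by rewrite ltnS -[leqRHS](size_iota 0 k) find_size.
pose ix a m := if m < a then m.*2.+1 else m.*2.+2.
have ixP w m : w \in off -> m < k -> ix (c w) m < l /\ e (v (ix (c w) m)) w.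
  move=> wO; rewrite /ix; elim: m => [|m IH] mk;
    [case: (ltnP 0 (c w)) => cm | case: (ltnP m.+1 (c w)) => cm].
  - have [i ei [iE|iE]] := pairs w 0 wO mk; first by split; rewrite -[0.*2.+1]iE.
    have := before_find 0 cm; rewrite nth_iota // add0n /= -[0.*2.+2]iE ei.
    by rewrite ltn_ord.
  - have h : has (fun m => e (v m.*2.+2) w && (m.*2.+2 < l)) (iota 0 k).
      by rewrite has_find size_iota -/(c w); lia.
    have := nth_find 0 h; rewrite -/(c w); have -> : c w = 0 by lia.
    by rewrite nth_iota // add0n => /andP[].
  - have [i ei [iE|iE]] := pairs w m.+1 wO mk; first by split; rewrite -[m.+1.*2.+1]iE.
    have := before_find 0 cm; rewrite nth_iota // add0n /= -[m.+1.*2.+2]iE ei.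
    by rewrite ltn_ord.
  have [cE|cm'] := eqVneq (c w) m.+1.
    have h : has (fun m => e (v m.*2.+2) w && (m.*2.+2 < l)) (iota 0 k).
      by rewrite has_find size_iota -/(c w) cE.
    have := nth_find 0 h; rewrite -/(c w) cE.
    by rewrite nth_iota // add0n => /andP[].
  have cm2 : (m < c w) = false by lia.
  have [l1 e1] := IH (ltnW mk); rewrite cm2 in l1 e1.
  have [i ei [iE|iE]] := pairs w m.+1 wO mk.
    have il := ltn_ord i.
    have := @off_nonconsecutive w m.*2.+2 wO; rewrite e1.
    have -> : m.*2.+3 = i by rewrite iE; lia.
    by rewrite ei il => /(_ isT isT).
  by split; rewrite -[m.+1.*2.+2]iE.
pose M (a : 'I_k.+1) := [set w in off | c w == a].
pose a := [arg max_(a > ord0) #|M a|].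
have amax b : #|M b| <= #|M a| by rewrite /a; case: arg_maxnP => // a' _ h; apply: h.
have cO : #|off| <= k.+1 * #|M a|.
  have -> : #|off| = \sum_(b < k.+1) #|M b|.
    rewrite -sum1_card (partition_big (fun w => Ordinal (ck w)) predT) //=.
    apply: eq_bigr => b _; rewrite -sum1_card; apply: eq_bigl => w.
    by rewrite [RHS]inE -val_eqE.
  have -> : k.+1 * #|M a| = \sum_(b < k.+1) #|M a| by rewrite sum_nat_const card_ord.
  by apply: leq_sum => b _; apply: amax.
have [w0] : exists w, w \in M a.
  by apply/set0Pn; rewrite -card_gt0; have := cO; rewrite -card_gt0 in O0; case: #|M a| => //; lia.
rewrite inE => /andP[w0O /eqP cw0].
exists [set v (ix a (m : 'I_k)) | m : 'I_k], (M a); split=> //.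
- apply/subsetP => _ /imsetP[m _ ->]; have [h _] := ixP w0 m w0O (ltn_ord m).
  by case/and3P: pB => _ _ /allP; apply; apply: mem_nth; rewrite -cw0.
- rewrite card_imset ?card_ord // => m m' /eqP.
  have [h _] := ixP w0 m w0O (ltn_ord m); have [h' _] := ixP w0 m' w0O (ltn_ord m').
  rewrite cw0 in h h'; case/and3P: pB => up _ _; rewrite nth_uniq // /ix => /eqP hm.
  by apply: val_inj => /=; move: hm; do 2!case: ifP => _; lia.
move=> _ w /imsetP[m _ ->]; rewrite inE => /andP[wO /eqP cw].
by rewrite -cw; have [] := ixP w m wO (ltn_ord m).
Qed.

End Longest.
End Paths.

(** * Degrees, clusters and hubs in connected sets without long paths *)

Section Structure.
Variables (T : finType) (e : rel T).
Hypotheses (e_sym : symmetric e) (e_irr : irreflexive e).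

Definition connected_in (B : {set T}) : Prop :=
  forall S : {set T}, S \subset B -> S != set0 ->
  {in S, forall u, nbrs e B u \subset S} -> S = B.

(** Absence of a path on [2k+3] vertices; part (a) assumes more, so this form serves both parts. *)
Definition short_paths k (B : {set T}) : Prop :=
  forall p, upath e B p -> size p <= 2 * k + 2.

Lemma ex_longest_path k B : short_paths k B ->
  exists2 p, upath e B p & forall p', upath e B p' -> size p' <= size p.
Proof. by move=> sB; apply: ex_longest_seq sB _; exists [::]. Qed.

Lemma card_off B p : upath e B p -> #|B| = size p + #|off B p|.
Proof.
case/and3P => up _ /allP pS.
have pB : [set u in p] \subset B by apply/subsetP => u; rewrite inE => /pS.
rewrite -(cardsID [set u in p] B) (setIidPr pB) cardsE.
by rewrite (card_uniqP up).
Qed.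

(** With all degrees at least [k+1], a longest rooted path would contradict [rooted_min_degree]; a
    set with more than [2k+2] vertices does have vertices off its longest path. *)
Lemma short_paths_min_degree k B : B != set0 -> connected_in B -> short_paths k B ->
  #|B| <= 2 * k + 2 \/ exists2 u, u \in B & #|nbrs e B u| <= k.
Proof.
move=> B0 cB sB; case: (leqP #|B| (2 * k + 2)) => hB; [by left|right].
have [u /andP[uB hu]|no] := pickP [pred u in B | #|nbrs e B u| <= k].
  by exists u.
have [p pB pmax] := ex_longest_path sB; have pk := sB p pB.
have [b bB] := set0Pn _ B0.
have O0 : off B p != set0.
  by rewrite -card_gt0; have := card_off pB; move: hB pk; clear; lia.
have [q rq qmax] := ex_longest_rooted b e_sym pB pmax pk cB B0 O0.
have degB : {in B, forall w, k.+1 <= #|nbrs e B w|}.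
  by move=> w wB; rewrite ltnNge; apply: contraFN (no w) => h; rewrite inE wB.
by have := rooted_min_degree e_sym e_irr pB pmax pk qmax degB rq erefl; rewrite ltnn.
Qed.

(** The cases are a longest rooted path with at least two vertices, which yields a cluster [Q], or
    with one vertex, which yields a hub. The summand [2k+2] pays for the vertices of the longest
    path. *)
Lemma short_paths_structure k B : B != set0 -> connected_in B -> short_paths k B ->
  0 < k -> 2 * k + 2 < #|B| -> {in B, forall w, k <= #|nbrs e B w|} ->
  (exists s (Q N : {set T}),
     [/\ (s = k /\ 1 < k) \/ (k = 3 /\ s = 2), [/\ Q \subset B, N \subset B & #|Q| = s],
         #|N| <= (k - s).+1 & {in Q, forall u, nbrs e B u \subset Q :|: N}]) \/
  exists K M : {set T}, [/\ K \subset B, #|K| = k, #|B| <= 2 * k + 2 + k.+1 * #|M| &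
    {in K & M, forall u w, e u w}].
Proof.
move=> B0 cB sB k0 hB degB.
have [p pB pmax] := ex_longest_path sB; have pk := sB p pB.
have [b bB] := set0Pn _ B0.
have O0 : off B p != set0.
  by rewrite -card_gt0; have := card_off pB; move: hB pk; clear; lia.
have [q rq qmax] := ex_longest_rooted b e_sym pB pmax pk cB B0 O0.
have [s1|s1] := leqP (size q) 1.
  right; have [q' rq'|K [M [KB cK cO KM]]] :=
    ex_common_nbrs e_sym e_irr pB pmax pk cB degB k0 O0 (x0 := b).
    exact: leq_trans (qmax q' rq') s1.
  exists K, M; split=> //; rewrite (card_off pB).
  by move: pk cO; clear; nia.
left; have [_ [_ sk]] := pos_head_last e_sym e_irr pB pmax pk qmax degB erefl rq erefl s1.
have [Q [N [QB NB cQ cN QN]]] := rooted_cluster e_sym e_irr pB pmax pk qmax degB erefl rq erefl s1.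
exists (size q), Q, N; split=> //.
by case: sk s1 => [->|]; [left|right].
Qed.

End Structure.

Local Open Scope ring_scope.

(** * Auxiliary inequalities *)

Section Inequalities.
Variable R : realFieldType.

Lemma bernoulli (y : R) m : 0 <= y <= 1 -> 1 - m%:R * y <= (1 - y) ^+ m.
Proof.
move=> /andP[y0 y1]; elim: m => [|m IH]; first by rewrite mul0r subr0 expr0.
have y1' : 0 <= 1 - y by rewrite subr_ge0.
rewrite exprS; apply: le_trans (ler_wpM2l y1' IH).
rewrite -natr1; have m0 : 0 <= m%:R :> R by rewrite ler0n.
nra.
Qed.

(** Arithmetic-geometric mean for [q] factors [1 - y] and [P - q] factors 1. *)
Lemma weighted_bernoulli (y : R) q P : (q <= P)%N -> (0 < P)%N -> 0 <= y <= 1 ->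
  (1 - y) ^+ q <= (1 - q%:R * y / P%:R) ^+ P.
Proof.
move=> qP P0 /andP[y0 y1].
pose E (i : 'I_P) := if (i < q)%N then 1 - y else 1.
have E0 : {in predT, forall i, 0 <= E i}.
  by move=> i _; rewrite /E; case: ifP => _; rewrite ?subr_ge0 // ler01.
have [+ _] := leif_AGM E0.
have cq : #|[pred i : 'I_P | (i < q)%N]| = q.
  rewrite -sum1_card /= -(big_ord_widen P (fun=> 1%N)) //.
  by rewrite sum_nat_const card_ord muln1.
have -> : \prod_(i in predT) E i = (1 - y) ^+ q.
  rewrite (bigID (fun i : 'I_P => (i < q)%N)) /= [X in _ * X]big1 ?mulr1.
    rewrite (eq_bigr (fun=> 1 - y)) => [|i h]; last by rewrite /E h.
    by rewrite prodr_const -{2}cq; congr (_ ^+ _); apply: eq_card => i; rewrite !inE.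
  by move=> i h; rewrite /E (negPf h).
have -> : \sum_(i in predT) E i = P%:R - q%:R * y.
  have -> : \sum_(i in predT) E i = \sum_(i < P) (1 - (if (i < q)%N then y else 0)).
    by apply: eq_bigr => i _; rewrite /E; case: ifP => _; rewrite ?subr0.
  rewrite sumrB sumr_const card_ord -big_mkcond /= sumr_const mulr_natl.
  by congr (_ - _ *+ _); rewrite -[RHS]cq.
have -> : #|(predT : pred 'I_P)| = P by rewrite cardT size_enum_ord.
by rewrite mulrBl divff // pnatr_eq0 -lt0n.
Qed.

(** Cross-multiplied monotonicity of [(b+a)^(2a+1) / b^(2a)], whose logarithmic derivative has the
    sign of [b - 2a^2]. *)
Lemma pow_ratio_mono (b n : R) a : 2 * a%:R ^+ 2 <= b -> b <= n -> 0 < b ->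
  (b + a%:R) ^+ a.*2.+1 * n ^+ a.*2 <= (n + a%:R) ^+ a.*2.+1 * b ^+ a.*2.
Proof.
move=> ab bn b0; have n0 : 0 < n by apply: lt_le_trans bn.
set A : R := a%:R in ab *; have A0 : 0 <= A by rewrite ler0n.
have bA0 : 0 < b + A by rewrite ltr_pwDl.
(* Chosen so that [(n+A) b = (b+A) n (1-y)]; Bernoulli's inequality then replaces
   differentiation. *)
pose y := A * (n - b) / ((b + A) * n).
have y01 : 0 <= y <= 1.
  apply/andP; split; first by rewrite divr_ge0 ?mulr_ge0 ?subr_ge0 // ltW.
  rewrite ler_pdivrMr ?mulr_gt0 // mul1r; nra.
have nbE : (n + A) * b = ((b + A) * n) * (1 - y) by rewrite /y; field; lra.
rewrite !exprS -!mulrA -!exprMn nbE [in leRHS]exprMn mulrCA.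
apply: le_trans (_ : (n + A) * (((b + A) * n) ^+ a.*2 * (1 - a.*2%:R * y)) <= _); last first.
  rewrite [leRHS]mulrCA; apply: ler_wpM2l; first lra.
  by apply: ler_wpM2l; [rewrite exprn_ge0 // mulr_ge0 // ltW | apply: bernoulli].
rewrite [leRHS]mulrCA [leLHS]mulrC; apply: ler_wpM2l; first by rewrite exprn_ge0 // mulr_ge0 // ltW.
rewrite mulrBr mulr1 lerBrDr -lerBrDl.
have -> : a.*2%:R = 2 * A :> R by rewrite -muln2 natrM mulrC.
rewrite /y !mulrA ler_pdivrMr ?mulr_gt0 //.
have -> : (n + A) * 2 * A * A * (n - b) = (n - b) * (2 * A ^+ 2 * (n + A)) by ring.
have -> : n + A - (b + A) = n - b by ring.
apply: ler_wpM2l; first by rewrite subr_ge0.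
have : 2 * A ^+ 2 <= n by apply: le_trans bn.
nra.
Qed.

End Inequalities.

(** * Vertex sets maximising a spectral ratio *)

Section Optimal.
Variables (R : realType) (n : nat) (e : rel 'I_n).
Hypotheses (e_sym : symmetric e) (e_irr : irreflexive e).
Variables (mu : {set 'I_n} -> R) (px : {set 'I_n} -> 'I_n -> R).
Hypothesis perr : forall B, B != set0 -> perron e B (mu B) (px B).
Implicit Types B U : {set 'I_n}.

Definition optimal U p q B : Prop :=
  [/\ B \subset U, B != set0 & forall B', B' \subset U -> B' != set0 ->
     mu B' ^+ p * #|B|%:R ^+ q <= mu B ^+ p * #|B'|%:R ^+ q].

Lemma card_gt0R B : B != set0 -> 0 < #|B|%:R :> R.
Proof. by move=> B0; rewrite ltr0n card_gt0. Qed.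

Lemma ex_optimal U p q : U != set0 -> exists B, optimal U p q B.
Proof.
move=> U0; pose P B := (B \subset U) && (B != set0).
pose F B : R := mu B ^+ p / #|B|%:R ^+ q.
have PU : P U by rewrite /P subxx.
exists [arg max_(B > U | P B) F B]%O; case: Order.TotalTheory.arg_maxP => // B /andP[BU B0] h.
split=> // B' BU' B0'; have := h B'; rewrite /P BU' B0' => /(_ isT).
by rewrite /= /F ler_pdivrMr ?exprn_gt0 ?card_gt0R // mulrAC ler_pdivlMr ?exprn_gt0 ?card_gt0R.
Qed.

Section OptimalFacts.
Variables (U B : {set 'I_n}) (p q : nat).
Hypotheses (opt : optimal U p q B) (U0 : U != set0) (muU : 0 < mu U).
Hypotheses (q0 : (0 < q)%N) (qp : (q <= p)%N).
Notation x := (px B).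
Notation b := (#|B|%:R : R).

Let B0 : B != set0. Proof. by case: opt. Qed.
Let pB : perron e B (mu B) x. Proof. exact: perr. Qed.
Let p0 : (0 < p)%N. Proof. exact: leq_trans qp. Qed.
Let b0 : 0 < b. Proof. exact: card_gt0R. Qed.

Let D0 : 0 < p%:R * b + q%:R.
Proof. by rewrite addr_gt0 ?mulr_gt0 ?b0 ?ltr0n. Qed.

Lemma optimal_gt0 : 0 < mu B.
Proof.
have [BU _ /(_ U (subxx U) U0) h] := opt.
rewrite lt_neqAle (perron_ge0 pB) andbT; apply/eqP => m0.
have : 0 < mu U ^+ p * b ^+ q by rewrite mulr_gt0 // exprn_gt0.
by rewrite ltNge; apply/negP/negPn; apply: le_trans h _; rewrite -m0 expr0n eqn0Ngt p0 mul0r.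
Qed.

Lemma optimal_card : (1 < #|B|)%N.
Proof.
rewrite ltnNge; apply/negP => b1; have := optimal_gt0; apply/negP; rewrite -leNgt.
apply: (@perron_max_degree _ _ _ e_sym _ _ _ pB 0 optimal_gt0) => u uB; rewrite leqn0 cards_eq0.
apply/eqP/setP => w; rewrite !inE; apply/negP => /andP[wB].
have /card_le1_eqP/(_ u w uB wB) -> := b1; by rewrite e_irr.
Qed.

(* Deleting [u] cannot improve the objective; this bounds [x u] from below. *)
Lemma optimal_entry u : u \in B ->
  q%:R / (p%:R * b + q%:R) <= x u ^+ 2.
Proof.
move=> uB; set xi := x u ^+ 2.
have mB := optimal_gt0; have c1 := optimal_card.
have cE : #|B| = #|B :\ u|.+1 by rewrite (cardsD1 u B) uB.
have B'0 : B :\ u != set0 by rewrite -card_gt0; move: c1; rewrite cE.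
have xi0 : 0 <= xi by apply: sqr_ge0.
have xi2 : xi *+ 2 <= 1 by apply: (perron_half e_sym e_irr pB) uB mB.
have xi1 : 0 < 1 - xi by lra.
have del : mu B * (1 - xi *+ 2) <= mu (B :\ u) * (1 - xi).
  exact: (perron_delete e_sym e_irr pB uB (perr B'0)).
have [BU _ /(_ (B :\ u)) h] := opt.
have /h/(_ B'0) {}h : B :\ u \subset U by apply: subset_trans BU; apply: subD1set.
have b1E : #|B :\ u|%:R = b - 1 by rewrite cE -natr1 addrK.
pose t := xi / (1 - xi).
have t1 : 0 <= 1 - t.
  by rewrite subr_ge0 /t ler_pdivrMr // mul1r; lra.
have mt : mu B * (1 - t) <= mu (B :\ u).
  rewrite -(ler_pM2r xi1); apply: le_trans del; rewrite -mulrA.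
  have -> : (1 - t) * (1 - xi) = 1 - xi *+ 2 by rewrite /t; field; lra.
  by [].
have y01 : 0 <= b^-1 <= 1.
  by rewrite invr_ge0 ltW //= invf_le1 // ler1n ltnW.
(* The deletion estimate and optimality give [(1-t)^p <= (1-1/b)^q]. Hence [t >= q/(pb)], and
   solving [t = xi/(1-xi)] for [xi] yields the claimed bound. *)
have main : (1 - t) ^+ p <= (1 - q%:R * b^-1 / p%:R) ^+ p.
  apply: le_trans (weighted_bernoulli qp p0 y01).
  have -> : 1 - b^-1 = (b - 1) / b by field; rewrite gt_eqF.
  rewrite expr_div_n ler_pdivlMr ?exprn_gt0 // -(ler_pM2l (exprn_gt0 p mB)).
  rewrite -b1E; apply: le_trans h; rewrite mulrA -exprMn.
  apply: ler_wpM2r; first by rewrite exprn_ge0 // ltW.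
  by apply: lerXn2r; rewrite ?nnegrE // ?mulr_ge0 // ?(ltW mB) // (perron_ge0 (perr B'0)).
have q1 : 0 < q%:R :> R by rewrite ltr0n.
have p1 : 0 < p%:R :> R by rewrite ltr0n.
have qpR : q%:R <= p%:R :> R by rewrite ler_nat.
have s1 : 0 <= 1 - q%:R * b^-1 / p%:R.
  rewrite subr_ge0 ler_pdivrMr // mul1r; apply: le_trans qpR.
  by rewrite ler_piMr ?(ltW q1) //; case/andP: y01.
have := main; rewrite ler_pXn2r ?nnegrE // lerD2l lerN2 /t => hq.
move: hq; rewrite ler_pdivlMr // ler_pdivrMr // => hq.
have : q%:R * (1 - xi) <= xi * (p%:R * b).
  have := hq; rewrite -(ler_pM2r (mulr_gt0 p1 b0)).
  have -> : q%:R * b^-1 / p%:R * (1 - xi) * (p%:R * b) = q%:R * (1 - xi).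
    by field; rewrite !gt_eqF.
  by [].
lra.
Qed.

Lemma optimal_entry_gt0 u : u \in B -> 0 < x u.
Proof.
move=> uB; have [x0 _ _ _] := pB; rewrite lt_neqAle x0 andbT; apply/eqP => xu.
by have := optimal_entry uB; rewrite -xu expr0n /= leNgt divr_gt0 ?ltr0n.
Qed.

(** A proper closed part would have at least the same spectral radius on fewer vertices. *)
Lemma optimal_connected : connected_in e B.
Proof.
move=> S SB S0 cl; apply/eqP; rewrite eqEcard SB leqNgt; apply/negP => lt.
have [BU _ /(_ S (subset_trans SB BU) S0) h] := opt.
have [u uS] := set0Pn _ S0.
have le : mu B <= mu S.
  apply: (perron_closed pB SB _ cl (perr S0)).
  by exists u => //; apply: optimal_entry_gt0; apply: (subsetP SB).
have mB := optimal_gt0.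
have : mu S ^+ p * #|S|%:R ^+ q < mu S ^+ p * b ^+ q.
  rewrite ltr_pM2l ?exprn_gt0 ?(lt_le_trans mB) //.
  by rewrite ltr_pXn2r ?nnegrE ?ler0n // ltr_nat.
rewrite ltNge; apply/negP/negPn; apply: le_trans h _.
apply: ler_wpM2r; first by rewrite exprn_ge0.
by apply: lerXn2r; rewrite ?nnegrE ?(ltW mB) // (le_trans (ltW mB)).
Qed.

Lemma optimal_degree u : u \in B ->
  mu B ^+ 2 * q%:R <= #|nbrs e B u|%:R *
    (p%:R * b + q%:R - (b - #|nbrs e B u|%:R) * q%:R).
Proof.
move=> uB; set d : R := #|nbrs e B u|%:R.
have := perron_degree pB uB optimal_entry; rewrite -/d => h.
have := h; rewrite -(ler_pM2r D0).
have -> : mu B ^+ 2 * (q%:R / (p%:R * b + q%:R)) * (p%:R * b + q%:R) = mu B ^+ 2 * q%:R.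
  by field; rewrite gt_eqF.
have -> : d * (1 - (b - d) * (q%:R / (p%:R * b + q%:R))) * (p%:R * b + q%:R) =
    d * (p%:R * b + q%:R - (b - d) * q%:R).
  by field; rewrite gt_eqF.
by [].
Qed.

(** Summing the eigen-equations over [Q] gives [(mu B - (s-1)) X <= s Y], with [X], [Y] the sums of
    entries over [Q] and [N]. The entry bound makes [X] large, and Cauchy-Schwarz turns [Y] into the
    mass of [N]. *)
Lemma optimal_cluster (Q N : {set 'I_n}) : Q \subset B -> N \subset B -> Q != set0 ->
  #|Q|%:R - 1 <= mu B -> {in Q, forall u, nbrs e B u \subset Q :|: N} ->
  (mu B - (#|Q|%:R - 1)) ^+ 2 * q%:R <=
    #|N|%:R * (\sum_(u in N) x u ^+ 2) * (p%:R * b + q%:R).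
Proof.
move=> QB NB Q0 sm cl; have [x0 _ xe _] := pB.
set s : R := #|Q|%:R in sm *.
have s0 : 0 < s by apply: card_gt0R.
set bet := q%:R / (p%:R * b + q%:R).
have bet0 : 0 <= bet by rewrite divr_ge0 ?ler0n // ltW.
pose X := \sum_(u in Q) x u; pose Y := \sum_(u in N) x u.
have XE : (mu B - (s - 1)) * X <= s * Y.
  suff : mu B * X <= (s - 1) * X + s * Y by lra.
  have -> : (s - 1) * X + s * Y = \sum_(u in Q) (X - x u + Y).
    by rewrite big_split sumrB /= !sumr_const -[X *+ _]mulr_natl -[Y *+ _]mulr_natl -/X -/s; ring.
  rewrite mulr_sumr; apply: ler_sum => u uQ; rewrite -xe ?(subsetP QB) //.
  have -> : X - x u = \sum_(v in Q :\ u) x v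
    by rewrite /X [in LHS](big_setD1 u uQ) /= addrAC subrr add0r.
  have mono (S1 S2 : {set 'I_n}) : S1 \subset S2 -> \sum_(v in S1) x v <= \sum_(v in S2) x v.
    by move=> S12; rewrite [leRHS](big_setID S1) /= (setIidPr S12) lerDl sumr_ge0.
  rewrite (big_setID (Q :\ u)) /=; apply: lerD; apply: mono; first exact: subsetIr.
  apply/subsetP => v; rewrite !inE => /and3P[+ vB euv].
  have -> : v != u by apply: contraTneq euv => ->; rewrite e_irr.
  have := subsetP (cl u uQ) v; rewrite !inE vB euv => /(_ isT).
  by case: (v \in Q).
have XB : s * Num.sqrt bet <= X.
  rewrite mulr_natl -sumr_const; apply: ler_sum => u uQ.
  rewrite -[x u]ger0_norm // -sqrtr_sqr ler_wsqrtr ?optimal_entry //.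
  exact: (subsetP QB).
have key : (mu B - (s - 1)) * Num.sqrt bet <= Y.
  rewrite -(ler_pM2l s0); apply: le_trans XE; rewrite mulrCA.
  by apply: ler_wpM2l => //; rewrite subr_ge0.
have key2 : (mu B - (s - 1)) ^+ 2 * bet <= #|N|%:R * \sum_(u in N) x u ^+ 2.
  apply: le_trans (sum_CauchySchwarz _ _).
  rewrite -(sqr_sqrtr bet0) -exprMn; apply: lerXn2r; rewrite ?nnegrE ?sumr_ge0 //.
  by rewrite mulr_ge0 ?sqrtr_ge0 // subr_ge0.
have := key2; rewrite -(ler_pM2r D0); apply: le_trans.
have Dn : p%:R * b + q%:R != 0 by rewrite gt_eqF.
by rewrite -[leRHS]mulrA [bet * _]divfK.
Qed.

End OptimalFacts.

(** The constant is the ratio of the complete graph on [2k+2] vertices, whose spectral radius is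
    [2k+1]. An optimum with at most [2k+2] vertices has [mu B <= b - 1]; a larger one has a vertex
    of degree at most [k], so that [mu B ^+ 2 <= k (b+k+1)]. *)
Lemma short_paths_ratio U k : (0 < k)%N -> U != set0 -> short_paths e k U ->
  mu U ^+ 2 * (2 * k + 2)%:R <= (2 * k + 1)%:R ^+ 2 * #|U|%:R.
Proof.
move=> k0 U0 sU.
have [muU|muU] := ltP 0 (mu U); last first.
  have -> : mu U = 0 by apply/eqP; rewrite eq_le muU (perron_ge0 (perr U0)).
  by rewrite expr0n mul0r mulr_ge0 ?exprn_ge0 ?ler0n.
have [B opt] := ex_optimal 2 1 U0; have [BU B0 h] := opt.
have q0 : (0 < 1)%N by []. have qp : (1 <= 2)%N by [].
have b0 := card_gt0R B0.
suff hB : mu B ^+ 2 * (2 * k + 2)%:R <= (2 * k + 1)%:R ^+ 2 * #|B|%:R.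
  rewrite -(ler_pM2r b0); have := h U (subxx U) U0; rewrite !expr1 => h1.
  have := ler_wpM2r (ler0n R (2 * k + 2)) h1.
  have := ler_wpM2r (ler0n R #|U|) hB.
  lra.
have sB : short_paths e k B by move=> p pB; apply: sU; apply: upath_sub pB.
have cB := optimal_connected opt U0 muU q0 qp.
have mB := optimal_gt0 opt U0 muU q0 qp.
set b : R := #|B|%:R in b0 *.
have k1 : 1 <= k%:R :> R by rewrite ler1n.
have kE : (2 * k + 2)%:R = 2 * k%:R + 2 :> R by rewrite natrD natrM.
have kE' : (2 * k + 1)%:R = 2 * k%:R + 1 :> R by rewrite natrD natrM.
rewrite kE kE'.
have [bk|bk] := leqP #|B| (2 * k + 2).
  have mb : mu B <= b - 1.
    have -> : b - 1 = #|B|.-1%:R by rewrite /b -subn1 natrB // card_gt0.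
    apply: (perron_max_degree e_sym (perr B0) mB) => u uB.
    rewrite -ltnS prednK ?card_gt0 //; apply: proper_card; apply/properP; split.
      by apply/subsetP => w; rewrite inE => /andP[].
    by exists u => //; rewrite inE e_irr andbF.
  have bk' : b <= 2 * k%:R + 2 by rewrite -kE ler_nat.
  have b1 : 1 <= b by rewrite ler1n card_gt0.
  have m2 : mu B ^+ 2 <= (b - 1) ^+ 2.
    by apply: lerXn2r; rewrite ?nnegrE ?(ltW mB) // subr_ge0.
  apply: le_trans (_ : (b - 1) ^+ 2 * (2 * k%:R + 2) <= _).
    by apply: ler_wpM2r => //; lra.
  rewrite -subr_ge0.
  have -> : (2 * k%:R + 1) ^+ 2 * b - (b - 1) ^+ 2 * (2 * k%:R + 2) =
    (2 * k%:R + 2 - b) * ((2 * k%:R + 2) * b - 1) by ring.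
  by rewrite mulr_ge0 ?subr_ge0 //; nra.
have [|[u uB uk]] := short_paths_min_degree e_sym e_irr B0 cB sB; first by rewrite leqNgt bk.
have := optimal_degree opt U0 muU q0 qp uB; rewrite -/b mulr1.
set d : R := #|_|%:R => hd.
have dk : d <= k%:R by rewrite ler_nat.
have d0 : 0 <= d by rewrite ler0n.
have bk' : 2 * k%:R + 3 <= b.
  have : (2 * k + 2).+1%:R <= b by rewrite ler_nat.
  by rewrite -natr1 kE; lra.
have m2 : mu B ^+ 2 <= k%:R * (b + k%:R + 1).
  apply: le_trans hd _; apply: le_trans (_ : d * (b + k%:R + 1) <= _).
    by apply: ler_wpM2l => //; lra.
  by apply: ler_wpM2r => //; lra.
nra.
Qed.

End Optimal.

(** * Size and spectral radius of the optimal set *)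

Section CoreSize.
Variables (R : realFieldType) (rho b n : R) (a : nat).
Notation k := (a.+1%:R : R).
Hypotheses (b0 : 0 < b) (n0 : 0 < n) (rho0 : 0 <= rho).

(** [rho] stands for [mu(B)^2]. Inserting the ratio bound into the optimality inequality leaves
    [(k(2k+2))^P n <= (2k+1)^(2P) b] with [P = 2k-1]. *)
Lemma core_size_bound :
  (k * n) ^+ a.*2.+1 * b ^+ a.*2 <= rho ^+ a.*2.+1 * n ^+ a.*2 ->
  rho * (2 * k + 2) <= (2 * k + 1) ^+ 2 * b ->
  2 * k * n <= (2 * k + 1) * 2 ^+ a.*2.+1 * b.
Proof.
move=> h1 h2; have [K KE] : exists K, K = k by exists k.
have k1 : 1 <= K by rewrite KE ler1n.
rewrite -KE in h1 h2 *; set P := a.*2.+1 in h1 *; set q := a.*2 in h1 *.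
set m := 2 * K + 1 in h2 *; have m0 : 0 < m by rewrite /m; lra.
have step1 : (K * (2 * K + 2)) ^+ P * n <= (m ^+ 2) ^+ P * b.
  have f0 : 0 < n ^+ q * b ^+ q by rewrite mulr_gt0 // exprn_gt0.
  rewrite -(ler_pM2r f0).
  have -> : (K * (2 * K + 2)) ^+ P * n * (n ^+ q * b ^+ q) =
      (K * n) ^+ P * b ^+ q * (2 * K + 2) ^+ P.
    by rewrite !exprMn /P exprS [n ^+ q.+1]exprS; ring.
  have -> : (m ^+ 2) ^+ P * b * (n ^+ q * b ^+ q) = (m ^+ 2 * b) ^+ P * n ^+ q.
    by rewrite [in RHS]exprMn /P [b ^+ q.+1]exprS; ring.
  apply: le_trans (_ : rho ^+ P * n ^+ q * (2 * K + 2) ^+ P <= _).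
    by apply: ler_wpM2r => //; rewrite exprn_ge0 //; lra.
  rewrite mulrAC -exprMn; apply: ler_wpM2r; first by rewrite exprn_ge0 // ltW.
  apply: lerXn2r => //; rewrite nnegrE ?mulr_ge0 ?exprn_ge0 // ?(ltW m0) ?(ltW b0) //; lra.
have y01 : 0 <= (m ^+ 2)^-1 <= 1.
  rewrite invr_ge0 ltW ?exprn_gt0 //= invf_le1 ?exprn_gt0 // exprn_ege1 // /m; lra.
have := bernoulli P y01.
have m20 : 0 < m ^+ 2 by rewrite exprn_gt0.
(* Since [2k(2k+2) = m^2 - 1], the base [k(2k+2)/m^2] is half of [1 - 1/m^2]: the halves produce
   [2^P], and Bernoulli's inequality controls the rest. *)
have -> : 1 - (m ^+ 2)^-1 = (K * (2 * K + 2)) * 2 / m ^+ 2.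
  by rewrite /m; field; rewrite gt_eqF.
have PE : P%:R = 2 * K - 1 :> R.
  by rewrite KE /P -[in RHS]natr1 -natr1 -muln2 natrM; ring.
rewrite expr_div_n ler_pdivlMr ?exprn_gt0 // [X in _ <= X]exprMn => h3.
have h4 : 2 * K / m <= 1 - P%:R / m ^+ 2.
  rewrite -subr_ge0 PE.
  have -> : 1 - (2 * K - 1) / m ^+ 2 - 2 * K / m = 2 / m ^+ 2.
    by rewrite /m; field; rewrite gt_eqF.
  by rewrite divr_ge0 // ltW.
have h5 : 2 * K / m * (m ^+ 2) ^+ P <= (K * (2 * K + 2)) ^+ P * 2 ^+ P.
  apply: le_trans h3; apply: ler_wpM2r => //; by rewrite exprn_ge0 // ltW.
have M0 : 0 < (m ^+ 2) ^+ P by rewrite exprn_gt0.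
rewrite -(ler_pM2r M0).
have -> : 2 * K * n * (m ^+ 2) ^+ P = m * n * (2 * K / m * (m ^+ 2) ^+ P).
  by field; rewrite gt_eqF.
apply: le_trans (_ : m * n * ((K * (2 * K + 2)) ^+ P * 2 ^+ P) <= _).
  by apply: ler_wpM2l => //; rewrite mulr_ge0 // ltW.
have -> : m * n * ((K * (2 * K + 2)) ^+ P * 2 ^+ P) =
  m * 2 ^+ P * ((K * (2 * K + 2)) ^+ P * n) by ring.
have -> : m * 2 ^+ P * b * (m ^+ 2) ^+ P = m * 2 ^+ P * ((m ^+ 2) ^+ P * b) by ring.
by apply: ler_wpM2l => //; rewrite mulr_ge0 ?exprn_ge0 ?(ltW m0).
Qed.

(** If the bound failed for [B], optimality would contradict [pow_ratio_mono]. *)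
Lemma core_radius (rhoU : R) : 2 * a%:R ^+ 2 <= b -> b <= n ->
  k * (n + a%:R) < rhoU ->
  rhoU ^+ a.*2.+1 * b ^+ a.*2 <= rho ^+ a.*2.+1 * n ^+ a.*2 ->
  k * (b + a%:R) < rho.
Proof.
move=> ab bn hU h; rewrite ltNge; apply/negP => hr.
have k0 : 0 < k by rewrite ltr0n.
have a0 : 0 <= a%:R :> R by rewrite ler0n.
have k1 : 0 <= k * (n + a%:R) by apply: (mulr_ge0 (ltW k0)); rewrite addr_ge0 // ltW.
have k2 : 0 <= k * (b + a%:R) by apply: (mulr_ge0 (ltW k0)); rewrite addr_ge0 // ltW.
have l1 : (k * (n + a%:R)) ^+ a.*2.+1 * b ^+ a.*2 < rhoU ^+ a.*2.+1 * b ^+ a.*2.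
  rewrite ltr_pM2r ?exprn_gt0 // ltr_pXn2r // nnegrE //.
  by apply: le_trans (ltW hU).
have l2 : rho ^+ a.*2.+1 * n ^+ a.*2 <= (k * (b + a%:R)) ^+ a.*2.+1 * n ^+ a.*2.
  apply: ler_wpM2r; first by rewrite exprn_ge0 // ltW.
  by apply: lerXn2r; rewrite ?nnegrE.
have := lt_le_trans l1 (le_trans h l2).
rewrite !exprMn -!mulrA ltr_pM2l ?exprn_gt0 // ltNge.
by rewrite pow_ratio_mono.
Qed.

End CoreSize.

(** In order: the threshold of [pow_ratio_mono], room for [k+3] common neighbours, [mu(B) >= 7(k-1)]
    for clique clusters, and [mu(B) >= 13] for edge clusters when [k = 3]. *)
Lemma core_size_nat k b : (1 < k)%N -> (4 * k * 4 ^ k <= (2 * k + 1) * b)%N ->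
  [/\ (2 * k.-1 ^ 2 <= b)%N, (2 * k + 2 + k.+1 * (k + 2) < b)%N,
      (49 * k.-1 ^ 2 <= k * (b + k.-1))%N & (k = 3 -> 169 <= k * (b + k.-1))%N].
Proof.
move=> k1 h.
have [k3|k4] := leqP k 3.
  have [kE|kE] : (k = 2 \/ k = 3)%N by lia.
    by subst k; split; lia.
  by subst k; split; lia.
have h4 : (16 * k ^ 2 <= 4 ^ k)%N.
  have [j ->] : exists j, k = (j + 4)%N by exists (k - 4)%N; lia.
  elim: j => [//|j IH]; rewrite addSn [(4 ^ _.+1)%N]expnS; move: (4 ^ _)%N IH => X; clear; nia.
have h5 : (64 * k ^ 3 <= (2 * k + 1) * b)%N.
  by apply: leq_trans h; rewrite expnS; nia.
have hb : (21 * k ^ 2 <= b)%N by nia.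
have [a kE] : exists a, k = a.+1 by exists k.-1; lia.
rewrite kE /= in hb k4 *; split; nia.
Qed.

(* The next two lemmas exclude the clusters of [short_paths_structure]; in the
   first one [a] stands for [k - 1]. *)
Lemma clique_cluster_contra (R : realFieldType) (mu b a : R) : 1 <= a -> 7 * a <= mu ->
  (a + 1) * (b + a) < mu ^+ 2 ->
  (mu - a) ^+ 2 * (2 * a) *+ 2 <= 2 * (2 * a + 1) * b + 2 * a -> (1 < a -> 2 <= a) -> False.
Proof.
move=> a1 ma hb h a2.
have h1 : 2 * a * (a + 1) * (mu - a) ^+ 2 < (2 * a + 1) * mu ^+ 2 - 2 * a ^+ 2 * (a + 1).
  have : (a + 1) * ((mu - a) ^+ 2 * (2 * a) *+ 2) <= (a + 1) * (2 * (2 * a + 1) * b + 2 * a).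
    by apply: ler_wpM2l => //; lra.
  nra.
(* For [a = 1] the estimate [h4] below would need [147 <= 144]. There [h1] reads
   [mu^2 - 8 mu + 8 < 0], which already fails from [mu = 7] on. *)
have [a3|a3] := ltP 1 a; last first.
  have aE : a = 1 by lra.
  rewrite aE in h1 ma; nra.
have {}a2 := a2 a3.
have h2 : 36 * mu ^+ 2 <= 49 * (mu - a) ^+ 2 by nra.
have h3 : 2 * a * (a + 1) * (36 * mu ^+ 2) <= 2 * a * (a + 1) * (49 * (mu - a) ^+ 2).
  by apply: ler_wpM2l => //; nra.
have h4 : 49 * (2 * a + 1) * mu ^+ 2 <= 72 * a * (a + 1) * mu ^+ 2.
  by apply: ler_wpM2r; rewrite ?sqr_ge0 //; nra.
have h5 : 0 <= a ^+ 2 * (a + 1) by rewrite mulr_ge0 ?sqr_ge0 //; lra.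
lra.
Qed.

Lemma edge_cluster_contra (R : realFieldType) (mu b m : R) : 13 <= mu -> 0 <= b ->
  3 * (b + 2) < mu ^+ 2 -> mu * m *+ 2 <= mu + m ->
  (mu - 1) ^+ 2 * 4 <= 2 * m * (10 * b + 4) -> False.
Proof.
move=> m13 b0 hb hm h.
have m1 : m * (2 * mu - 1) <= mu by lra.
have h1 : (mu - 1) ^+ 2 * (2 * (2 * mu - 1)) <= mu * (10 * b + 4).
  have : (mu - 1) ^+ 2 * 4 * (2 * mu - 1) <= 2 * m * (10 * b + 4) * (2 * mu - 1).
    by apply: ler_wpM2r => //; lra.
  have : m * (2 * mu - 1) * (10 * b + 4) <= mu * (10 * b + 4).
    by apply: ler_wpM2r => //; lra.
  lra.
have h2 : mu * (10 * b + 4) < mu * (10 * (mu ^+ 2 / 3 - 2) + 4).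
  by rewrite ltr_pM2l; lra.
(* What remains is the cubic [(2/3) mu^3 - 10 mu^2 + 24 mu - 2 < 0]; it holds at 12 and fails from
   13 on. *)
have : 0 <= (mu - 13) * mu * (mu - 2) by rewrite !mulr_ge0; lra.
nra.
Qed.

(** * Existence of a hub *)

Section Hub.
Variables (R : realType) (n : nat) (e : rel 'I_n).
Hypotheses (e_sym : symmetric e) (e_irr : irreflexive e).
Variables (mu : {set 'I_n} -> R) (px : {set 'I_n} -> 'I_n -> R).
Hypothesis perr : forall B, B != set0 -> perron e B (mu B) (px B).
Implicit Types B U K M : {set 'I_n}.

Lemma hub_of_large_radius k U : (1 < k)%N -> (2 ^ (4 * k) <= n)%N -> U != set0 ->
  short_paths e k U -> k%:R * (n%:R + k.-1%:R) < mu U ^+ 2 ->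
  exists K M, [/\ K \subset U, #|K| = k, (k + 3 <= #|M|)%N & {in K & M, forall u w, e u w}].
Proof.
move=> k1 nk U0 sU hU; set a := k.-1 in hU.
have kE : k = a.+1 by rewrite prednK // ltnW.
have a1 : (0 < a)%N by rewrite -ltnS -kE.
have n0 : 0 < n%:R :> R by rewrite ltr0n; apply: leq_trans nk; rewrite expn_gt0.
have kR0 : 0 < k%:R :> R by rewrite ltr0n ltnW.
have aR0 : 0 <= a%:R :> R by rewrite ler0n.
have muU : 0 < mu U.
  rewrite lt_neqAle (perron_ge0 (perr U0)) andbT; apply/eqP => m0.
  by move: hU; rewrite -m0 expr0n /= ltNge (mulr_ge0 (ltW kR0)) // addr_ge0 // ltW.
pose q := a.*2; pose P := a.*2.+1; pose p := P.*2.
have q0 : (0 < q)%N by rewrite double_gt0.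
have qp : (q <= p)%N by rewrite /p /P /q; move: (a); clear; lia.
have [B opt] := ex_optimal mu p q U0; have [BU B0 hopt] := opt.
set b : R := #|B|%:R; have b0 : 0 < b by apply: card_gt0R.
have mB := optimal_gt0 perr opt U0 muU q0 qp.
have sB : short_paths e k B by move=> s sB; apply: sU; apply: upath_sub sB.
have cmpP : (mu U ^+ 2) ^+ P * b ^+ q <= (mu B ^+ 2) ^+ P * n%:R ^+ q.
  rewrite -!exprM !mul2n -/p; apply: le_trans (hopt U (subxx U) U0) _.
  apply: ler_wpM2l; first by rewrite exprn_ge0 // ltW.
  apply: lerXn2r; rewrite ?nnegrE ?ler0n // ler_nat.
  by apply: leq_trans (max_card _) _; rewrite card_ord.
have hsize : (4 * k * 4 ^ k <= (2 * k + 1) * #|B|)%N.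
  have rat := short_paths_ratio e_sym e_irr perr (ltnW k1) B0 sB.
  have h1 : (a.+1%:R * n%:R) ^+ P * b ^+ q <= (mu B ^+ 2) ^+ P * n%:R ^+ q.
    apply: le_trans cmpP; apply: ler_wpM2r; first by rewrite exprn_ge0 // ltW.
    apply: lerXn2r; rewrite ?nnegrE ?sqr_ge0 // -?kE; first by rewrite mulr_ge0 // ltW.
    by apply: le_trans (ltW hU); rewrite ler_pM2l // lerDl.
  have h2 : mu B ^+ 2 * (2 * a.+1%:R + 2) <= (2 * a.+1%:R + 1) ^+ 2 * b.
    have -> : 2 * a.+1%:R + 2 = (2 * k + 2)%:R :> R by rewrite natrD natrM kE.
    have -> : 2 * a.+1%:R + 1 = (2 * k + 1)%:R :> R by rewrite natrD natrM kE.
    exact: rat.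
  have := core_size_bound b0 n0 (sqr_ge0 _) h1 h2; rewrite -kE -/P => h3.
  have h4 : 2 * k%:R * (2 ^ (4 * k))%:R <= (2 * k%:R + 1) * 2 ^+ P * b.
    apply: le_trans h3; apply: ler_wpM2l; first by rewrite mulr_ge0 // ltW.
    by rewrite ler_nat.
  have h5 : (2 * k * 2 ^ (4 * k) <= (2 * k + 1) * 2 ^ P * #|B|)%N.
    rewrite -(ler_nat R) natrM [(2 * k)%:R]natrM.
    by rewrite [in leRHS]natrM [((2 * k + 1) * _)%:R]natrM natrD natrM [(2 ^ P)%:R]natrX.
  have e2 : (2 ^ (4 * k) = 2 ^ P * 2 * 4 ^ k)%N.
    rewrite -[4%N]/(2 ^ 2)%N -expnM -expnSr -expnD; congr (_ ^ _)%N.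
    by rewrite /P kE; move: (a); clear; lia.
  have e3 : (0 < 2 ^ P)%N by rewrite expn_gt0.
  rewrite -(leq_pmul2l e3).
  move: h5; rewrite e2; move: (2 ^ P)%N (4 ^ k)%N #|B| => X Y Z; clear; nia.
have [c1 c2 c3 c4] := core_size_nat k1 hsize.
have rad : k%:R * (b + a%:R) < mu B ^+ 2.
  rewrite kE; apply: (core_radius b0 n0 _ _ (rhoU := mu U ^+ 2)) => //.
  - exact: sqr_ge0.
  - by rewrite -natrX -natrM ler_nat.
  - by rewrite ler_nat; apply: leq_trans (max_card _) _; rewrite card_ord.
  - by rewrite -kE.
have degB : {in B, forall w, (k <= #|nbrs e B w|)%N}.
  move=> w wB; rewrite leqNgt; apply/negP => dk.
  have := optimal_degree e_sym e_irr perr opt U0 muU q0 qp wB; rewrite -/b.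
  set d : R := #|_|%:R => hd.
  have da : d <= a%:R by rewrite ler_nat -ltnS -kE.
  have d0 : 0 <= d by rewrite ler0n.
  have pE : p%:R = 2 * (2 * a%:R + 1) :> R.
    by rewrite /p /P -!muln2 natrM -natr1 natrM; ring.
  have qE : q%:R = 2 * a%:R :> R by rewrite /q -muln2 natrM mulrC.
  have kRE : k%:R = a%:R + 1 :> R by rewrite kE -natr1.
  have aR1 : 1 <= a%:R :> R by rewrite ler1n.
  move: hd rad; rewrite pE qE kRE.
  set A : R := a%:R in aR1 aR0 da *; clearbody A.
  move=> hd rad.
  (* The right side of the degree bound increases with [d]; at [d = k-1] it equals [2A (A+1)(b+A)],
     exactly what [rad] excludes. *)
  have h1 : d * (2 * (2 * A + 1) * b + 2 * A - (b - d) * (2 * A)) <=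
      A * (2 * (2 * A + 1) * b + 2 * A - (b - A) * (2 * A)).
    apply: le_trans (_ : d * (2 * (2 * A + 1) * b + 2 * A - (b - A) * (2 * A)) <= _).
      by apply: ler_wpM2l => //; rewrite lerD2l lerN2 ler_wpM2r //; lra.
    apply: ler_wpM2r => //; nra.
  have : mu B ^+ 2 * (2 * A) <= 2 * A * ((A + 1) * (b + A)).
    apply: le_trans hd _; apply: le_trans h1 _.
    by rewrite le_eqVlt; apply/orP; left; apply/eqP; ring.
  rewrite mulrC ler_pM2l; last lra.
  by rewrite leNgt rad.
have cB := optimal_connected e_sym e_irr perr opt U0 muU q0 qp.
have b22 : (2 * k + 2 < #|B|)%N by apply: leq_ltn_trans c2; apply: leq_addr.
have [|[K [M [KB cK cM KM]]]] :=
  short_paths_structure e_sym e_irr B0 cB sB (ltnW k1) b22 degB; last first.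
  exists K, M; split=> //; first exact: subset_trans BU.
  by have := leq_trans c2 cM; rewrite ltn_add2l ltn_mul2l addn3 addn2.
case=> s [Q [N [sk [QB NB cQ] cN QN]]]; exfalso.
have s0 : (1 < s)%N by case: sk => [[-> //]|[_ ->]].
have Q0 : Q != set0 by rewrite -card_gt0 cQ ltnW.
have mB2 : (k * (#|B| + k.-1))%:R < mu B ^+ 2 by rewrite natrM natrD.
have mu7 : 7 * a%:R <= mu B.
  rewrite -(@ler_pXn2r _ 2) ?nnegrE ?(ltW mB) ?mulr_ge0 //.
  apply: le_trans (ltW mB2); rewrite exprMn -natrX -natrX -natrM ler_nat.
  exact: c3.
have sm : #|Q|%:R - 1 <= mu B.
  apply: le_trans mu7; rewrite cQ lerBlDr; apply: le_trans (_ : k%:R <= _).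
    by rewrite ler_nat; case: sk => [[-> _]|[-> ->]].
  have aR1 : 1 <= a%:R :> R by rewrite ler1n.
  by rewrite kE -natr1; lra.
have := optimal_cluster e_sym e_irr perr opt U0 muU q0 qp QB NB Q0 sm QN.
have := perron_mass e_sym e_irr (perr B0) NB.
set m := \sum_(u in N) _; rewrite cQ -/b.
have m0 : 0 <= m by apply: sumr_ge0 => u _; apply: sqr_ge0.
have pE : p%:R = 2 * (2 * a%:R + 1) :> R.
  by rewrite /p /P -!muln2 natrM -natr1 natrM; ring.
have qE : q%:R = 2 * a%:R :> R by rewrite /q -muln2 natrM mulrC.
have aR1 : 1 <= a%:R :> R by rewrite ler1n.
rewrite pE qE.
have D0 : 0 <= 2 * (2 * a%:R + 1) * b + 2 * a%:R.
  by rewrite addr_ge0 // ?mulr_ge0 // ?(ltW b0) //; lra.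
(* [h1] caps the mass [m] of [N]: [2m <= 1] when [|N| <= 1], and [2 mu m <= mu + m] when [|N| <= 2].
   [h2] is the mass that the cluster demands. *)
case: sk => [[sE _]|[k3 s2]] h1 h2.
  have N1 : #|N|%:R <= 1 :> R by rewrite -[1]/(1%:R) ler_nat; move: cN; rewrite sE subnn.
  have h1' : m *+ 2 <= 1.
    have : mu B * (m *+ 2) <= mu B * 1.
      rewrite mulr1 mulrnAr; apply: le_trans h1 _; rewrite gerDl.
      by apply: mulr_le0_ge0 => //; lra.
    by rewrite ler_pM2l.
  apply: (@clique_cluster_contra R (mu B) b a%:R) => //.
  - by move: rad; rewrite kE -natr1.
  - have kRE : k%:R - 1 = a%:R :> R by rewrite kE -natr1 addrK.
    rewrite sE kRE in h2.
    have h3 : #|N|%:R * m * (2 * (2 * a%:R + 1) * b + 2 * a%:R) <=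
        m * (2 * (2 * a%:R + 1) * b + 2 * a%:R).
      by apply: ler_wpM2r => //; rewrite -[leRHS]mul1r ler_wpM2r.
    have h4 : m *+ 2 * (2 * (2 * a%:R + 1) * b + 2 * a%:R) <=
       1 * (2 * (2 * a%:R + 1) * b + 2 * a%:R) by apply: ler_wpM2r.
    lra.
  - by rewrite -[1]/(1%:R) -[2]/(2%:R) ltr_nat ler_nat.
have a2 : a = 2%N by rewrite /a k3.
have N2 : #|N|%:R <= 2 :> R by rewrite -[2]/(2%:R) ler_nat; move: cN; rewrite k3 s2.
apply: (@edge_cluster_contra R (mu B) b m).
- rewrite -(@ler_pXn2r _ 2) ?nnegrE ?(ltW mB) //.
  apply: le_trans (ltW mB2); rewrite -natrX ler_nat; apply: leq_trans (c4 k3); by [].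
- exact: ltW.
- by move: rad; rewrite a2 k3.
- apply: le_trans h1 _; rewrite lerD2l -[leRHS]mul1r; apply: ler_wpM2r => //; lra.
rewrite s2 a2 in h2; move: h2.
have -> : 2 - 1 = 1 :> R by lra.
have -> : 2 * 2 = 4 :> R by lra.
have -> : 2 * (4 + 1) * b + 4 = 10 * b + 4 by ring.
move=> h2; apply: le_trans h2 _.
apply: ler_wpM2r; first by rewrite addr_ge0 ?mulr_ge0 // ltW.
exact: ler_wpM2r.
Qed.

Lemma ex_hub k U : (0 < k)%N -> (2 ^ (4 * k) <= n)%N -> U != set0 ->
  short_paths e k U -> k%:R * (n%:R - k%:R) <= mu U ^+ 2 - (k%:R - 1) * mu U ->
  exists K M, [/\ K \subset U, #|K| = k, (k + 3 <= #|M|)%N & {in K & M, forall u w, e u w}].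
Proof.
move=> k0 nk U0 sU hU; have m0 := perron_ge0 (perr U0).
have [k1|k1] := leqP k 1; last first.
  apply: hub_of_large_radius => //.
  have nk' : (64 * k ^ 2 <= n)%N.
    apply: leq_trans nk; rewrite expnM -[(2 ^ 4)%N]/16%N.
    have [j ->] : exists j, k = (j + 2)%N by exists (k - 2)%N; lia.
    elim: j => [//|j IH]; rewrite addSn [(16 ^ _.+1)%N]expnS.
    by move: (16 ^ _)%N IH => X; clear; nia.
  have : (64 * k ^ 2)%:R <= n%:R :> R by rewrite ler_nat.
  have -> : k.-1%:R = k%:R - 1 :> R by rewrite -subn1 natrB.
  have : 2 <= k%:R :> R by rewrite -[2]/(2%:R) ler_nat.
  rewrite natrM natrX; move: hU m0.
  set N : R := n%:R; set k' : R := k%:R; set x := mu U => hU m0 k2 hn.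
  (* Once [mu >= 2k+3], the linear term [(k-1) mu] exceeds [k(2k-1)], the gap between [k(n-k)] and
     [k(n+k-1)]. *)
  have h1 : (2 * k' + 3) ^+ 2 <= x ^+ 2 by nra.
  have h2 : 2 * k' + 3 <= x.
    by rewrite -(@ler_pXn2r _ 2) ?nnegrE //; lra.
  nra.
have kE : k = 1%N by lia.
subst k; rewrite subrr mul0r subr0 mul1r in hU.
have [x0 xn xe _] := perr U0; have [u0 u0U] := set0Pn _ U0.
pose u := [arg max_(v > u0 | v \in U) px U v]%O.
have [uU umax] : u \in U /\ forall v, v \in U -> px U v <= px U u.
  by rewrite /u; case: Order.TotalTheory.arg_maxP.
have xu : 0 < px U u.
  rewrite lt_neqAle x0 andbT; apply/eqP => z.
  have : \sum_(v in U) px U v ^+ 2 = 0.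
    apply: big1 => v vU; have -> : px U v = 0; last by rewrite expr0n.
    by apply/eqP; rewrite eq_le x0 andbT z umax.
  by rewrite xn => /eqP; rewrite oner_eq0.
have md : mu U <= #|nbrs e U u|%:R.
  rewrite -(ler_pM2r xu) -xe //; apply: le_trans (_ : \sum_(v in nbrs e U u) px U u <= _).
    by apply: ler_sum => v; rewrite inE => /andP[vU _]; apply: umax.
  by rewrite sumr_const mulr_natl.
exists [set u], (nbrs e U u); split; first by rewrite sub1set.
- by rewrite cards1.
- rewrite ltnNge; apply/negP => d3.
  have : mu U ^+ 2 <= 3 ^+ 2.
    apply: lerXn2r; rewrite ?nnegrE //; apply: le_trans md _.
    by rewrite -[3]/(3%:R) ler_nat.
  have : 16 <= n%:R :> R by rewrite -[16]/(16%:R) ler_nat.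
  lra.
by move=> _ w /set1P -> ; rewrite inE => /andP[].
Qed.

End Hub.

(** * Paths through a hub *)

Local Open Scope nat_scope.

Section HubPaths.
Variables (T : finType) (e : rel T) (x0 : T).
Hypotheses (e_sym : symmetric e) (e_irr : irreflexive e).
Variables (K M : {set T}) (k : nat).
Hypotheses (cK : #|K| = k) (cM : k + 3 <= #|M|)
  (KM : {in K & M, forall u w, e u w}).

Lemma hub_disjoint u : u \in K -> u \notin M.
Proof. by move=> uK; apply/negP => uM; have := KM uK uM; rewrite e_irr. Qed.

Fixpoint interleave (s t : seq T) : seq T :=
  if s is a :: s' then if t is b :: t' then a :: b :: interleave s' t' else [::]
  else [::].

Lemma interleave_perm s t : size s = size t -> perm_eq (interleave s t) (s ++ t).
Proof.
elim: s t => [|a s IH] [|b t] //= [st]; rewrite perm_cons.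
by rewrite perm_sym perm_catC /= perm_cons perm_sym perm_sym perm_catC perm_sym IH.
Qed.

Lemma interleave_path u s t : size s = size t -> {subset s <= K} -> {subset t <= M} ->
  (s != [::] -> e u (head x0 s)) -> path e u (interleave s t).
Proof.
elim: s t u => [|a s IH] [|b t] //= u [st] sK tM ua.
have aK : a \in K by apply: sK; rewrite mem_head.
have bM : b \in M by apply: tM; rewrite mem_head.
rewrite ua // KM //=; apply: IH => // [c cs|c ct|].
- by apply: sK; rewrite inE cs orbT.
- by apply: tM; rewrite inE ct orbT.
by case: s st sK => // c s _ sK _ /=; rewrite e_sym KM // sK // !inE eqxx orbT.
Qed.

Lemma interleave_last u s t : size s = size t -> last u (interleave s t) = last u t.
Proof. by elim: s t u => [|a s IH] [|b t] //= u [st]; rewrite IH. Qed.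

Lemma zigzag pre ks Y : upath e setT pre -> pre != [::] -> {in pre, forall u, u \notin K} ->
  uniq ks -> {subset ks <= K} -> ks != [::] -> e (last x0 pre) (head x0 ks) ->
  size pre + size Y + size ks <= #|M| ->
  exists p, [/\ upath e setT (pre ++ p), size p = 2 * size ks, p != [::], last x0 p \in M &
    {in p, forall u, u \in ks \/ (u \in M /\ u \notin Y)}].
Proof.
move=> /and3P[upre spre _] pre0 preK uks ksK ks0 eph cY.
pose A := M :\: [set u in pre ++ Y].
have cA : size ks <= #|A|.
  rewrite cardsD; have : #|M :&: [set u in pre ++ Y]| <= size (pre ++ Y).
    apply: leq_trans (subset_leq_card (subsetIr _ _)) _.
    by rewrite cardsE; apply: card_size.
  rewrite size_cat => h; rewrite -(leq_add2l #|M :&: [set u in pre ++ Y]|).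
  rewrite subnKC ?subset_leq_card ?subsetIl //.
  by apply: leq_trans cY; rewrite leq_add2r.
pose ms := take (size ks) (enum A).
have sms : size ks = size ms by rewrite size_take_min -cardE (minn_idPl cA).
have msA u : u \in ms -> u \in A by move/mem_take; rewrite mem_enum.
have msM : {subset ms <= M} by move=> u /msA; rewrite inE => /andP[].
have pp := interleave_perm sms.
have pE u : u \in interleave ks ms = (u \in ks) || (u \in ms).
  by rewrite (perm_mem pp) mem_cat.
have p0 : interleave ks ms != [::].
  by rewrite -size_eq0 (perm_size pp) size_cat addn_eq0 size_eq0 (negPf ks0).
exists (interleave ks ms); split=> //.
- apply/and3P; split; last by apply/allP => u _; rewrite inE.
  + rewrite cat_uniq upre (perm_uniq pp) cat_uniq uks take_uniq ?enum_uniq //= andbT.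
    apply/andP; split.
      apply/hasPn => u; rewrite pE => /orP[/ksK uK|/msA].
        by apply/negP => /preK; rewrite uK.
      by rewrite !inE mem_cat negb_or => /andP[/andP[]].
    apply/hasPn => u /msM uM; apply/negP => /ksK /hub_disjoint.
    by rewrite uM.
  + case: (pre) pre0 spre eph => [//|c pre'] _ /= pc eph.
    by rewrite cat_path pc /=; apply: interleave_path.
- by rewrite (perm_size pp) size_cat -sms mul2n addnn.
- have -> : last x0 (interleave ks ms) = last x0 ms by rewrite interleave_last.
  apply: msM; apply: last_in; rewrite -size_eq0 -sms size_eq0; exact: ks0.
move=> u; rewrite pE => /orP[->|ums]; [by left|right].
by have := msA u ums; rewrite !inE mem_cat negb_or => /andP[/andP[_ ->] ->].
Qed.

Lemma hub_enum kap : kap \in K -> let ks := kap :: enum (K :\ kap) in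
  [/\ uniq ks, {subset ks <= K} & size ks = k].
Proof.
move=> kK /=; split.
- by rewrite mem_enum !inE eqxx enum_uniq.
- by move=> u; rewrite inE mem_enum !inE => /orP[/eqP->|/andP[]].
- by rewrite -cardE -cK (cardsD1 kap K) kK.
Qed.

(** After [b, c] come all [k] hub vertices, each followed by one vertex of [M]. *)
Lemma hub_path2 b c kap : kap \in K -> b \notin K -> c \notin K -> e b c -> e c kap ->
  exists2 p, upath e setT p & size p = 2 * k + 2.
Proof.
move=> kK bK cnK ebc eck; have [u1 u2 u3] := hub_enum kK.
have bc : b != c by apply: contraTneq ebc => ->; rewrite e_irr.
have [||||||p [h1 h2 _ _ _]] := @zigzag [:: b; c] _ [::] _ _ _ u1 u2.
- by rewrite /upath /= inE bc ebc !inE.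
- by [].
- by move=> u; rewrite !inE => /orP[/eqP->|/eqP->].
- by [].
- by [].
- by rewrite u3 /=; move: cM; clear; lia.
by exists ([:: b; c] ++ p) => //; rewrite size_cat h2 u3 addnC.
Qed.

Lemma hub_path3 a b c kap : kap \in K -> a \notin K -> b \notin K -> c \notin K ->
  e a b -> e b c -> a != c -> e c kap -> exists2 p, upath e setT p & size p = 2 * k + 3.
Proof.
move=> kK aK bK cnK eab ebc ac eck; have [u1 u2 u3] := hub_enum kK.
have ab : a != b by apply: contraTneq eab => ->; rewrite e_irr.
have bc : b != c by apply: contraTneq ebc => ->; rewrite e_irr.
have [||||||p [h1 h2 _ _ _]] := @zigzag [:: a; b; c] _ [::] _ _ _ u1 u2.
- by rewrite /upath /= !inE negb_or ab ac bc eab ebc.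
- by [].
- by move=> u; rewrite !inE => /or3P[/eqP->|/eqP->|/eqP->].
- by [].
- by [].
- by rewrite u3 /=; move: cM; clear; lia.
by exists ([:: a; b; c] ++ p) => //; rewrite size_cat h2 u3 addnC.
Qed.

(** [b, c], then a zigzag through all hub vertices but [kap'], then [kap', c', b']: [2 + 2(k-1) + 3]
    vertices. The count [2 + 2 + (k-1)] demanded of [M] is where [k + 3] is sharp. *)
Lemma hub_path22 b c c' b' kap kap' : kap \in K -> kap' \in K -> kap != kap' ->
  {in [:: b; c; c'; b'], forall u, u \notin K} -> uniq [:: b; c; c'; b'] ->
  e b c -> e c kap -> e kap' c' -> e c' b' -> exists2 p, upath e setT p & size p = 2 * k + 3.
Proof.
move=> kK kK' kk' nK unq ebc eck eck' ecb'.
pose ks := kap :: enum (K :\ kap :\ kap').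
have kin : kap' \in K :\ kap by rewrite !inE eq_sym kk'.
have sk : (size ks).+1 = k.
  by rewrite /= -cardE -cK (cardsD1 kap K) kK (cardsD1 kap' (K :\ kap)) kin.
have uks : uniq ks by rewrite /= mem_enum !inE eqxx enum_uniq andbF.
have ksK : {subset ks <= K}.
  by move=> u; rewrite inE mem_enum !inE => /orP[/eqP->|/and3P[]].
have kks : kap' \notin ks by rewrite inE mem_enum !inE eqxx orbF eq_sym.
have := unq; rewrite /= !inE !negb_or => /and4P[/and3P[bc bc' bb'] /andP[cc' cb'] c'b' _].
have nb : b \notin K by apply: nK; rewrite !inE eqxx.
have nc : c \notin K by apply: nK; rewrite !inE eqxx orbT.
have nc' : c' \notin K by apply: nK; rewrite !inE eqxx !orbT.
have nb' : b' \notin K by apply: nK; rewrite !inE eqxx !orbT.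
have [||||||p [h1 h2 h3 h4 h5]] := @zigzag [:: b; c] ks [:: c'; b'] _ _ _ uks ksK.
- by rewrite /upath /= inE bc ebc !inE.
- by [].
- by move=> u; rewrite !inE => /orP[/eqP->|/eqP->].
- by [].
- by [].
- by move: cM sk; clear; rewrite /=; lia.
exists (([:: b; c] ++ p) ++ [:: kap'; c'; b']); last first.
  by rewrite size_cat size_cat h2; move: sk; clear; rewrite /=; lia.
apply: (@upath_cat _ _ x0) => //.
- rewrite /upath /= !inE negb_or eck' ecb' c'b' /= andbT !andbT.
  by apply/andP; split; [apply: contraNneq nc' => <- | apply: contraNneq nb' => <-].
- have hp u : u \in p -> u != kap' /\ u \notin [:: c'; b'].
    move=> /h5[uk|[uM uY]]; split=> //.
    + by apply: contraNneq kks => <-.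
    + apply: contraL (ksK u uk); rewrite !inE => /orP[/eqP->|/eqP->] //.
    + by apply: contraTneq uM => ->; apply: hub_disjoint.
  apply/hasPn => u ux; rewrite mem_cat; apply/negP => /orP[|/hp[uk uY]].
    by move: ux; rewrite !inE => /or3P[] /eqP-> /orP[] /eqP h;
      move: nb nc bc' bb' cc' cb'; rewrite -?h ?kK' ?eqxx.
  by move: ux uY; rewrite !inE (negPf uk) /= => ->.
move=> _ _; rewrite last_cat /=.
have -> : last c p = last x0 p by case: (p) h3.
by rewrite e_sym KM.
Qed.

End HubPaths.

Local Open Scope ring_scope.

(** * Components next to the hub *)

Section HubStructure.
Variables (n : nat) (e : rel 'I_n).
Hypotheses (e_sym : symmetric e) (e_irr : irreflexive e).
Variables (K M : {set 'I_n}) (k : nat).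
Hypotheses (k0 : (0 < k)%N) (cK : #|K| = k) (cM : (k + 3 <= #|M|)%N)
  (KM : {in K & M, forall u w, e u w}) (sG : short_paths e k setT).
Implicit Types a b c u v w : 'I_n.

Definition wnbrs c := nbrs e (~: K) c.
Definition hub_roots := [set c in ~: K | [exists kap in K, e c kap]].
(** The vertices within distance two of the hub; without long paths this set is already closed under
    adjacency. *)
Definition hub_comp := K :|: hub_roots :|: \bigcup_(c in hub_roots) wnbrs c.

Lemma rootsP c : reflect (c \notin K /\ exists2 kap, kap \in K & e c kap) (c \in hub_roots).
Proof.
rewrite inE inE; apply: (iffP andP) => [[cnK /existsP[kap /andP[]]]|[cnK [kap kK h]]].
  by move=> kK h; split=> //; exists kap.
by split=> //; apply/existsP; exists kap; rewrite kK.
Qed.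

Lemma no_long p : upath e setT p -> size p != (2 * k + 3)%N.
Proof. by move=> /sG; apply: contraTneq => ->; rewrite -ltnNge ltn_add2l. Qed.

(** Otherwise [a, b, c] followed by the hub is too long. Hence the components of [G - K] that touch
    the hub are stars. *)
Lemma root_leaf c b a : c \in hub_roots -> b \in wnbrs c -> a \in wnbrs b -> a = c.
Proof.
move=> /rootsP[cnK [kap kK eck]]; rewrite !inE => /andP[bK ecb] /andP[aK eba].
apply/eqP/negPn/negP => ac; rewrite e_sym in ecb; rewrite e_sym in eba.
have [p /no_long] := hub_path3 a e_sym e_irr cK cM KM kK aK bK cnK eba ecb ac eck.
by move/eqP.
Qed.

Lemma wnbrs_sym c b : c \notin K -> b \in wnbrs c -> c \in wnbrs b.
Proof. by move=> cK'; rewrite !inE cK' e_sym => /andP[_ ->]. Qed.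

Lemma hub_comp_closed u w : u \in hub_comp -> e u w -> w \in hub_comp.
Proof.
move=> uZ euw; have [wK|wK] := boolP (w \in K); first by rewrite !in_setU wK.
have wn : w \in wnbrs u by rewrite !inE wK.
move: uZ; rewrite !in_setU (negPf wK) /= -orbA => /or3P[uK|ur|/bigcupP[c cr uc]].
- suff -> : w \in hub_roots by [].
  by apply/rootsP; split=> //; exists u => //; rewrite e_sym.
- by apply/orP; right; apply/bigcupP; exists u.
- by rewrite (root_leaf cr uc wn) cr.
Qed.

Lemma hub_edge_root u v : u \in hub_comp -> u \notin K -> v \in wnbrs u ->
  u \in hub_roots \/ v \in hub_roots.
Proof.
move=> uZ uK vu; move: uZ; rewrite !in_setU (negPf uK) /=.
case/orP => [->|/bigcupP[c cr uc]]; [by left|right].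
by rewrite (root_leaf cr uc vu).
Qed.

(** By [root_leaf] the two edges are disjoint. If [c] or [b] saw a hub vertex other than one seen by
    [c'], the two edges could be joined through the hub by [hub_path22]. *)
Lemma double_root_nbrs c b c' b' : c \in hub_roots -> b \in hub_roots -> b \in wnbrs c ->
  c' \in hub_roots -> b' \in wnbrs c' -> ~ ((c' = c /\ b' = b) \/ (c' = b /\ b' = c)) ->
  (1 < k)%N /\ exists kap, [/\ kap \in K, nbrs e K c = [set kap] & nbrs e K b = [set kap]].
Proof.
move=> cr br bc cr' bc' neq.
have [cnK [k1 k1K ek1]] := rootsP _ cr; have [bnK [k2 k2K ek2]] := rootsP _ br.
have [cnK' [k3 k3K ek3]] := rootsP _ cr'.
have cb : c \in wnbrs b by apply: wnbrs_sym.
have cb' : c' \in wnbrs b' by apply: wnbrs_sym.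
have bnK' : b' \notin K by move: bc'; rewrite !inE => /andP[].
have e1 : e c b by move: bc; rewrite !inE => /andP[].
have e2 : e c' b' by move: bc'; rewrite !inE => /andP[].
have n1 : c' != c.
  apply/eqP => h; apply: neq; left; split=> //; rewrite h in bc'.
  exact: (root_leaf br cb bc').
have n2 : c' != b.
  apply/eqP => h; apply: neq; right; split=> //; rewrite h in bc'.
  exact: (root_leaf cr bc bc').
have n3 : b' != c.
  apply/eqP => h; rewrite h in cb'; apply: neq; right; split=> //.
  exact: (root_leaf br cb cb').
have n4 : b' != b.
  apply/eqP => h; rewrite h in cb'; apply: neq; left; split=> //.
  exact: (root_leaf cr bc cb').
have n5 : c != b by apply: contraTneq e1 => ->; rewrite e_irr.
have n6 : c' != b' by apply: contraTneq e2 => ->; rewrite e_irr.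
have two x y kap kap' : (x = b /\ y = c) \/ (x = c /\ y = b) ->
    kap \in K -> e y kap -> kap' \in K -> e c' kap' -> kap = kap'.
  move=> xy kK ey kK' ec'; apply/eqP/negPn/negP => kk'.
  have exy : e x y by case: xy => -[-> ->]; rewrite // e_sym.
  have nK : {in [:: x; y; c'; b'], forall u, u \notin K}.
    by case: xy => -[-> ->] u; rewrite !inE => /or4P[] /eqP->.
  have unq : uniq [:: x; y; c'; b'].
    rewrite /= !inE !negb_or n6 !andbT.
    have nE : (b != c) && (c != b) by rewrite n5 eq_sym n5.
    rewrite ![_ == c']eq_sym ![_ == b']eq_sym.
    by case: xy nE => -[-> ->] /andP[nbc ncb]; rewrite ?nbc ?ncb n1 n2 n3 n4.
  rewrite e_sym in ec'.
  have [p /no_long] := hub_path22 b e_sym e_irr cK cM KM kK kK' kk' nK unq exy ey ec' e2.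
  by move/eqP.
have E12 : k1 = k3 by apply: (two b c) => //; left.
have E23 : k2 = k3 by apply: (two c b) => //; right.
split.
  rewrite ltnNge; apply/negP => k1'.
  have kE : k = 1%N by apply/eqP; rewrite eqn_leq k1' k0.
  have ekc : e c k3 by rewrite -E12.
  (* For [k = 1] the two edges and their common hub vertex already form a path on [2k+3 = 5]
     vertices. *)
  have up : upath e setT [:: b; c; k3; c'; b'].
    rewrite /upath /= !inE !negb_or ekc (e_sym k3) ek3 e2 (e_sym b) e1 /=.
    have kx x : x \notin K -> x != k3 by apply: contraNneq => ->.
    rewrite [b == c]eq_sym [c == k3]eq_sym ![k3 == _]eq_sym ![_ == c']eq_sym ![_ == b']eq_sym.
    by rewrite n5 n1 n2 n3 n4 [b' == c']eq_sym n6 !kx.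
  by have := no_long up; rewrite kE.
exists k3; split=> //; apply/setP => kap; rewrite !inE.
- apply/andP/eqP => [[kK ec]|->]; first by apply: (two b c) => //; left.
  by rewrite -{2}E12.
- apply/andP/eqP => [[kK ec]|->]; first by apply: (two c b) => //; right.
  by rewrite -{2}E23.
Qed.

(** A vertex outside the hub that is not a root is a leaf of at most one root, by [root_leaf]. *)
Lemma leaves_card :
  (\sum_(c in hub_roots) #|wnbrs c :\: hub_roots| + #|hub_roots| <= #|~: K|)%N.
Proof.
have -> : (#|~: K| = #|~: K :\: hub_roots| + #|hub_roots|)%N.
  rewrite addnC -(cardsID hub_roots (~: K)); congr (_ + _)%N; apply: eq_card => u.
  by rewrite in_setI; case: rootsP => [[h _]|]; rewrite ?andbF // inE h.
rewrite leq_add2r.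
have -> : (\sum_(c in hub_roots) #|wnbrs c :\: hub_roots| =
   \sum_(c in hub_roots) \sum_(b in ~: K :\: hub_roots) (e c b : nat))%N.
  apply: eq_bigr => c _; rewrite -sum1_card big_mkcond [RHS]big_mkcond /=.
  apply: eq_bigr => b _; rewrite !inE; case: (b \in K) => //=; rewrite ?andbF //.
  by rewrite andbT; case: (~~ _) => //=; case: (e c b).
rewrite exchange_big /= -sum1_card; apply: leq_sum => b; rewrite inE => /andP[br bK].
have [/exists_inP[c cr ecb]|no] := boolP [exists c in hub_roots, e c b]; last first.
  rewrite big1 // => c cr; have := no; rewrite negb_exists => /forallP /(_ c).
  by rewrite negb_and cr /=; case: (e c b).
rewrite (bigD1 c) //= ecb big1 // => c' /andP[cr' cc'].
case E : (e c' b) => //; case/eqP: cc'.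
have bc : b \in wnbrs c by rewrite inE bK.
apply: (root_leaf cr bc); have [cnK' _] := rootsP _ cr'.
by rewrite inE inE cnK' e_sym.
Qed.

End HubStructure.

(** * Two root edges are impossible *)

Section RootWeights.
Variables (R : realType) (n : nat) (e : rel 'I_n).
Hypotheses (e_sym : symmetric e) (e_irr : irreflexive e).
Variables (K M : {set 'I_n}) (k : nat).
Hypotheses (k0 : (0 < k)%N) (cK : #|K| = k) (cM : (k + 3 <= #|M|)%N)
  (KM : {in K & M, forall u w, e u w}) (sG : short_paths e k setT).
Variables (mu : R) (x : 'I_n -> R).
Hypotheses (pG : perron e setT mu x) (xK : {in K, forall u, 0 < x u})
  (mu_big : k%:R * (n%:R - k%:R) <= mu ^+ 2 - (k%:R - 1) * mu).
Implicit Types b c u v w : 'I_n.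
Notation wnbrs := (wnbrs e K).
Notation roots := (hub_roots e K).
Let X : R := \sum_(u in K) x u.

Let x_ge0 u : 0 <= x u. Proof. by have [h _ _ _] := pG. Qed.
Let mu_ge0 : 0 <= mu. Proof. exact: perron_ge0 pG. Qed.
Let k1 : 1 <= k%:R :> R. Proof. by rewrite ler1n. Qed.

Let X_gt0 : 0 < X.
Proof.
have /set0Pn[u uK] : K != set0 by rewrite -card_gt0 cK.
by rewrite /X (bigD1 u) //= ltr_wpDr ?xK // sumr_ge0.
Qed.

Let x_le_X u : u \in K -> x u <= X.
Proof. by move=> uK; rewrite /X (bigD1 u) //= lerDl sumr_ge0. Qed.

Lemma eigen_split u :
  mu * x u = \sum_(v in nbrs e K u) x v + \sum_(v in wnbrs u) x v.
Proof.
have [_ _ xe _] := pG; rewrite -xe ?inE // (big_setID K) /=.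
by congr (_ + _); apply: eq_bigl => v; rewrite !inE //= andbC.
Qed.

Let hubM : M \subset roots.
Proof.
have /set0Pn[u uK] : K != set0 by rewrite -card_gt0 cK.
apply/subsetP => w wM; apply/rootsP; split; last by exists u => //; rewrite e_sym KM.
by apply: contraL wM => /(hub_disjoint e_irr KM).
Qed.

Let cKC : #|~: K|%:R = n%:R - k%:R :> R.
Proof. by rewrite cardsCs setCK card_ord cK natrB // -cK -[leqRHS]card_ord max_card. Qed.

Let hub_order : k%:R + 3 <= n%:R - k%:R :> R.
Proof.
rewrite -cKC -[3]/(3%:R) -natrD ler_nat; apply: leq_trans cM _.
apply: subset_leq_card; apply: subset_trans hubM _.
by apply/subsetP => u /rootsP[h _]; rewrite inE.
Qed.

(** A star of [t] leaves is charged [k X] per vertex. Leaves satisfy [mu x_b = x_c], so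
    [(mu^2 - t) x_c <= mu X], and the charge suffices because [(1+t)(mu^2 - t) - mu^2 = t (mu^2 - 1
    - t)], positive for [t > 0]. *)
Lemma leaf_root_weight c : c \in roots -> [disjoint wnbrs c & roots] ->
  mu * (#|nbrs e K c|%:R * x c) <= (1 + #|wnbrs c :\: roots|%:R) * (k%:R * X) /\
  (wnbrs c != set0 ->
   mu * (#|nbrs e K c|%:R * x c) < (1 + #|wnbrs c :\: roots|%:R) * (k%:R * X)).
Proof.
move=> cr dis; set t := #|wnbrs c|.
have -> : wnbrs c :\: roots = wnbrs c by apply/setDidPl.
rewrite -/t.
have tM : (t + #|M| <= #|~: K|)%N.
  rewrite /t -cardsUI (_ : wnbrs c :&: M = set0) ?cards0 ?addn0.
    apply: subset_leq_card; rewrite subUset; apply/andP; split.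
      by apply/subsetP => u; rewrite inE => /andP[].
    by apply: subset_trans hubM _; apply/subsetP => u /rootsP[h _]; rewrite inE.
  apply/eqP; rewrite setI_eq0; exact: disjointWr hubM dis.
have t1 : 1 + t%:R < mu ^+ 2.
  have : (t + 3)%:R <= n%:R - k%:R :> R.
    rewrite -cKC ler_nat; apply: leq_trans tM; rewrite leq_add2l.
    by apply: leq_trans cM; apply: leq_addl.
  rewrite natrD; have := mu_big; have := hub_order; have := mu_ge0; have := k1.
  have : 0 <= t%:R :> R by rewrite ler0n.
  set a : R := k%:R; set N : R := n%:R; set t' : R := t%:R; nra.
have leaf b : b \in wnbrs c -> mu * x b = x c.
  move=> bc; rewrite eigen_split.
  have bn : b \notin roots by apply: contraTN bc => br; rewrite (disjointFl dis br).
  have bK : b \notin K by move: bc; rewrite !inE => /andP[].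
  rewrite big_pred0 ?add0r => [|v]; last first.
    rewrite inE; apply: contraNF bn => /andP[vK ebv].
    by apply/rootsP; split=> //; exists v.
  rewrite (_ : wnbrs b = [set c]) ?big_set1 //; apply/setP => a; rewrite inE.
  apply/idP/eqP => [ab|->]; first exact: (root_leaf e_sym e_irr cK cM KM sG cr bc ab).
  by apply: wnbrs_sym => //; have [] := rootsP _ _ _ cr.
have eq1 : mu ^+ 2 * x c = mu * \sum_(v in nbrs e K c) x v + t%:R * x c.
  rewrite expr2 -mulrA eigen_split mulrDr; congr (_ + _).
  by rewrite mulr_sumr (eq_bigr (fun=> x c)) // sumr_const mulr_natl.
have S1 : \sum_(v in nbrs e K c) x v <= X.
  rewrite /X [leRHS](big_setID (nbrs e K c)) /= (setIidPr _) ?lerDl ?sumr_ge0 //.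
  by apply/subsetP => v; rewrite inE => /andP[].
have sk : #|nbrs e K c|%:R <= k%:R :> R.
  by rewrite ler_nat -cK; apply: subset_leq_card; apply/subsetP => v; rewrite inE => /andP[].
set S := \sum_(v in _) _ in eq1 S1.
have t0 : 0 <= t%:R :> R by rewrite ler0n.
have mx0 : 0 <= mu * x c by rewrite mulr_ge0.
have D0 : 0 < mu ^+ 2 - t%:R by lra.
have base : (mu ^+ 2 - t%:R) * (mu * x c) <= mu ^+ 2 * X.
  have -> : (mu ^+ 2 - t%:R) * (mu * x c) = mu ^+ 2 * S.
    have -> : mu ^+ 2 * S = mu * (mu * S) by ring.
    have -> : mu * S = mu ^+ 2 * x c - t%:R * x c by lra.
    ring.
  by apply: ler_wpM2l => //; apply: sqr_ge0.
have le1 : mu * (#|nbrs e K c|%:R * x c) <= k%:R * (mu * x c).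
  by rewrite mulrCA; apply: ler_wpM2r.
have kk : 0 < k%:R :> R by rewrite ltr0n.
have eqD : (mu ^+ 2 - t%:R) * ((1 + t%:R) * X) = mu ^+ 2 * X + t%:R * (mu ^+ 2 - 1 - t%:R) * X.
  by ring.
split.
  apply: le_trans le1 _; rewrite [leRHS]mulrCA ler_pM2l // -(ler_pM2l D0) eqD.
  apply: le_trans base _; rewrite lerDl mulr_ge0 ?(ltW X_gt0) // mulr_ge0 //; lra.
rewrite -card_gt0 -/t => tt.
apply: le_lt_trans le1 _; rewrite [ltRHS]mulrCA ltr_pM2l // -(ltr_pM2l D0) eqD.
apply: le_lt_trans base _; rewrite ltrDl mulr_gt0 ?X_gt0 // mulr_gt0 ?ltr0n //; lra.
Qed.

Section TwoRootEdges.
Variables c0 b0 c1 b1 : 'I_n.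
Hypotheses (c0r : c0 \in roots) (b0c : b0 \in wnbrs c0)
  (c1r : c1 \in roots) (b1c : b1 \in wnbrs c1)
  (neq : ~ ((c1 = c0 /\ b1 = b0) \/ (c1 = b0 /\ b1 = c0))).

(** One of the two given root edges differs from [c b], so both ends see a single common hub vertex.
    Then [x_c = x_b < X] and [mu x_c = x_kap + x_c < 2X <= k X]. *)
Lemma double_root_weight c b : c \in roots -> b \in roots -> b \in wnbrs c ->
  mu * (#|nbrs e K c|%:R * x c) < (1 + #|wnbrs c :\: roots|%:R) * (k%:R * X).
Proof.
move=> cr br bc.
have [k2 [kap [kK Nc Nb]]] :
    (1 < k)%N /\ exists kap, [/\ kap \in K, nbrs e K c = [set kap] & nbrs e K b = [set kap]].
  have d := double_root_nbrs e_sym e_irr k0 cK cM KM sG cr br bc.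
  have [/orP h|h] := boolP (((c0 == c) && (b0 == b)) || ((c0 == b) && (b0 == c))).
    apply: (d c1 b1) => // h'; apply: neq.
    by case: h => /andP[/eqP-> /eqP->]; case: h' => -[-> ->]; auto.
  apply: (d c0 b0) => // h'; case/negP: h.
  by case: h' => -[-> ->]; rewrite !eqxx ?orbT.
have cnK : c \notin K by have [] := rootsP _ _ _ cr.
have cb : c \in wnbrs b by apply: wnbrs_sym.
have Wc : wnbrs c = [set b].
  apply/setP => a; rewrite in_set1; apply/idP/eqP => [ac|->] //.
  exact: (root_leaf e_sym e_irr cK cM KM sG br cb ac).
have Wb : wnbrs b = [set c].
  apply/setP => a; rewrite in_set1; apply/idP/eqP => [ab|->] //.
  exact: (root_leaf e_sym e_irr cK cM KM sG cr bc ab).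
have := eigen_split c; rewrite Nc Wc !big_set1 => Ec.
have := eigen_split b; rewrite Nb Wb !big_set1 => Eb.
have kX := x_le_X kK; have kR2 : 2 <= k%:R :> R by rewrite -[2]/(2%:R) ler_nat.
have mu2 : 2 < mu.
  have := mu_big; have := hub_order; have := mu_ge0; move: kR2.
  set a : R := k%:R; set N : R := n%:R => *; nra.
have xcb : x c = x b.
  have : (mu + 1) * (x c - x b) = 0 by lra.
  by move/eqP; rewrite mulf_eq0 subr_eq0 => /orP[/eqP h|/eqP //]; lra.
have xc : x c < X.
  have := X_gt0; have := x_ge0 c; rewrite -xcb in Ec; nra.
rewrite cards1 mul1r Ec -xcb.
apply: lt_le_trans (_ : k%:R * X <= _).
  by have := X_gt0; nra.
by rewrite mulrDl mul1r lerDl !mulr_ge0 // ?ltW // ?X_gt0 // ?ltr0n.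
Qed.

(** The eigen-equations summed over [K] bound [mu X] by [(k-1) X] plus the weights of the roots.
    Multiplied by [mu], these weights total less than [k(n-k) X], the strictness coming from the
    root edge at [c0]. *)
Lemma two_root_edges_absurd : False.
Proof.
have wt c : c \in roots ->
    mu * (#|nbrs e K c|%:R * x c) <= (1 + #|wnbrs c :\: roots|%:R) * (k%:R * X) /\
    (wnbrs c != set0 ->
     mu * (#|nbrs e K c|%:R * x c) < (1 + #|wnbrs c :\: roots|%:R) * (k%:R * X)).
  move=> cr; have [dis|] := boolP [disjoint wnbrs c & roots]; first exact: leaf_root_weight.
  rewrite -setI_eq0 => /set0Pn[b]; rewrite in_setI => /andP[bc br].
  have h := double_root_weight cr br bc; split=> //; exact: ltW.
have sumK : mu * X <= (k%:R - 1) * X + \sum_(c in roots) #|nbrs e K c|%:R * x c.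
  rewrite mulr_sumr.
  have -> : (k%:R - 1) * X = \sum_(u in K) (X - x u).
    by rewrite sumrB sumr_const cK mulrBl mul1r mulr_natl.
  have -> : \sum_(c in roots) #|nbrs e K c|%:R * x c =
      \sum_(u in K) \sum_(c in wnbrs u) x c.
    transitivity (\sum_(c in ~: K) \sum_(u in K) (e u c)%:R * x c).
      rewrite [RHS](big_setID roots) /= [X in _ = _ + X]big1 ?addr0 => [|c]; last first.
        rewrite inE => /andP[cr cnK]; apply: big1 => u uK.
        case E : (e u c); last by rewrite mul0r.
        case/negP: cr; apply/rootsP; split; first by rewrite inE in cnK.
        by exists u => //; rewrite e_sym.
      apply: eq_big => [c|c cr].
        rewrite in_setI; case: (boolP (c \in roots)) => [cr|]; rewrite ?andbF // andbT.
        by have [h _] := rootsP _ _ _ cr; rewrite inE h.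
      rewrite -mulr_suml -sum1_card natr_sum; congr (_ * _).
      rewrite (sum_nbrs e K c (fun=> 1)); apply: eq_bigr => u _.
      by rewrite mulr1 e_sym.
    rewrite exchange_big /=; apply: eq_bigr => u _.
    by rewrite (sum_nbrs e (~: K) u x).
  rewrite -big_split /=; apply: ler_sum => u uK; rewrite eigen_split lerD2r.
  have -> : X - x u = \sum_(v in K :\ u) x v.
    by rewrite /X [in LHS](big_setD1 u uK) /= addrAC subrr add0r.
  rewrite [leRHS](big_setID (nbrs e K u)) /= (setIidPr _) ?lerDl ?sumr_ge0 //.
  apply/subsetP => v; rewrite !inE => /andP[vK euv]; rewrite vK andbT.
  by apply: contraTneq euv => ->; rewrite e_irr.
have strict : \sum_(c in roots) mu * (#|nbrs e K c|%:R * x c) <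
    \sum_(c in roots) (1 + #|wnbrs c :\: roots|%:R) * (k%:R * X).
  rewrite (bigD1 c0) //= [ltRHS](bigD1 c0) //=; apply: ltr_leD.
    by have [_] := wt c0 c0r; apply; apply/set0Pn; exists b0.
  by apply: ler_sum => c /andP[cr _]; have [] := wt c cr.
have kX0 : 0 <= k%:R * X by rewrite mulr_ge0 ?ler0n // ltW // X_gt0.
have cnt : \sum_(c in roots) (1 + #|wnbrs c :\: roots|%:R) * (k%:R * X) <=
    (n%:R - k%:R) * (k%:R * X).
  rewrite -mulr_suml; apply: ler_wpM2r => //.
  rewrite big_split /= sumr_const -natr_sum -natrD -cKC ler_nat addnC.
  exact: (leaves_card e_sym e_irr cK cM KM sG).
rewrite -mulr_sumr in strict.
have := lt_le_trans strict cnt; have := ler_wpM2l mu_ge0 sumK.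
set S := \sum_(c in roots) _ => h1 h2.
have h3 : mu ^+ 2 * X < ((k%:R - 1) * mu + k%:R * (n%:R - k%:R)) * X by lra.
by move: h3; rewrite ltr_pM2r ?X_gt0 //; have := mu_big; lra.
Qed.

End TwoRootEdges.
End RootWeights.

(** * Comparison with the extremal graph *)

Lemma path_or_short (n r : nat) (e : rel 'I_n) :
  has_path n r e \/ forall p, upath e setT p -> (size p < r)%N.
Proof.
have [/existsP[t /and3P[ut st _]]|no] := boolP [exists t : r.-tuple 'I_n, upath e setT t].
  left; exists (tnth t); split.
    move=> i j; have x0 := tnth t i; rewrite !(tnth_nth x0) => /eqP.
    by rewrite nth_uniq ?size_tuple // => /eqP; apply: val_inj.
  move=> i j ji.
  have x0 := tnth t i.
  have /(sortedP x0)/(_ i) := st; rewrite size_tuple -ji ltn_ord => /(_ isT).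
  by rewrite !(tnth_nth x0).
right=> p up; rewrite ltnNge; apply: contra no => rp.
have st : size (take r p) == r by rewrite size_take_min (minn_idPl rp).
apply/existsP; exists (Tuple st); case/and3P: up => u1 u2 _.
apply/and3P; split; [exact: take_uniq | exact: take_sorted |].
by apply/allP => v _; rewrite inE.
Qed.

Section Comparison.
Variables (R : realType) (n : nat).
Implicit Types (e t : rel 'I_n).

Lemma perron_eigenvalue t (mu : R) h : symmetric t -> perron t setT mu h ->
  eigenvalue (adj_mx R t) mu.
Proof.
move=> t_sym [_ hn he _]; apply/eigenvalueP; exists (\row_i h i).
  apply/rowP => j; rewrite !mxE -he ?inE // (sum_nbrs t setT j h).
  by apply: eq_big => [i|i _]; rewrite ?inE // !mxE mulrC t_sym.
apply: contra_eq_neq hn => /rowP hz; rewrite big1 1?eq_sym ?oner_neq0 // => i _.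
by have := hz i; rewrite !mxE => ->; rewrite expr0n.
Qed.

Lemma eigenvalue_le_perron e (mu lam : R) x : symmetric e -> perron e setT mu x ->
  eigenvalue (adj_mx R e) lam -> lam <= mu.
Proof.
move=> e_sym [_ _ _ ray] /eigenvalueP[z zA z0].
have z2 : 0 < \sum_(u in setT) z 0 u ^+ 2.
  have := mxform1_gt0 z0; rewrite mxform1.
  by congr (_ < _); apply: eq_bigl => i; rewrite inE.
rewrite -(ler_pM2r z2); apply: le_trans (ray (z 0)).
rewrite mulr_sumr; apply: ler_sum => u _; rewrite -mulr_sumr.
have -> : \sum_(v in nbrs e setT u) z 0 v = lam * z 0 u.
  have /rowP/(_ u) := zA; rewrite !mxE => <-.
  rewrite (sum_nbrs e setT u (z 0)).
  by apply: eq_big => [i|i _]; rewrite ?inE // mxE mulrC e_sym.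
by rewrite expr2 mulrCA.
Qed.

(** Only the inclusion of [S_edge] is assumed, so both extremal graphs are covered. Vertex 0
    dominates, which gives positivity. The clique sum [X] and the remaining sum [Y] satisfy
    [mu X = (k-1) X + k Y] and [mu Y >= (n-k) X]. *)
Lemma target_perron t k (mu : R) h : symmetric t -> irreflexive t -> (0 < k < n)%N ->
  (forall u v, S_edge n k u v -> t u v) -> perron t setT mu h ->
  [/\ forall u, 0 < h u, k%:R - 1 <= mu & k%:R * (n%:R - k%:R) <= mu ^+ 2 - (k%:R - 1) * mu].
Proof.
move=> t_sym t_irr /andP[k0 kn] St [h0 hn he _].
pose C := [set u : 'I_n | (u < k)%N].
have cC : #|C| = k.
  have -> : C = [set widen_ord (ltnW kn) i | i : 'I_k].
    apply/setP => u; rewrite inE; apply/idP/imsetP => [uk|[i _ ->]]; last exact: ltn_ord i.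
    by exists (Ordinal uk) => //; apply: val_inj.
  by rewrite card_imset ?card_ord // => i j /(congr1 val) /= h'; apply: val_inj.
have tC u v : u \in C -> v != u -> t u v.
  by rewrite inE => uC vu; apply: St; rewrite /S_edge eq_sym vu uC.
have heE u : mu * h u = \sum_(v in nbrs t setT u) h v by rewrite he ?inE.
have nC u : u \in C -> nbrs t setT u = setT :\ u.
  move=> uC; apply/setP => v; rewrite !inE /= andbT.
  by have [->|vu] := eqVneq v u; rewrite ?t_irr // tC.
pose o : 'I_n := Ordinal (ltn_trans k0 kn).
have oC : o \in C by rewrite inE.
have ho : 0 < h o.
  rewrite lt_neqAle h0 andbT; apply/eqP => z.
  have := heE o; rewrite -z mulr0 nC // => /esym/eqP; rewrite psumr_eq0 // => /allP hz.
  have : \sum_(u in setT) h u ^+ 2 = 0.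
    apply: big1 => u _; have [->|uo] := eqVneq u o; first by rewrite -z expr0n.
    have := hz u (mem_index_enum _); rewrite !inE uo /= => /eqP->.
    by rewrite expr0n.
  by rewrite hn => /eqP; rewrite oner_eq0.
have muh u : u != o -> h o <= mu * h u.
  move=> uo; rewrite heE (bigD1 o) /= ?lerDl ?sumr_ge0 //.
  by rewrite !inE t_sym tC.
pose w : 'I_n := Ordinal kn.
have wo : w != o by rewrite -val_eqE /= -lt0n.
have mu0 : 0 < mu.
  rewrite ltNge; apply/negP => m0; have := muh w wo; rewrite leNgt.
  by rewrite (le_lt_trans _ ho) // mulr_le0_ge0.
have hpos u : 0 < h u.
  have [->//|uo] := eqVneq u o.
  by rewrite -(pmulr_rgt0 _ mu0); apply: lt_le_trans (muh u uo).
pose X := \sum_(u in C) h u; pose Y := \sum_(u in ~: C) h u.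
have X0 : 0 < X by rewrite /X (bigD1 o) //= ltr_wpDr ?sumr_ge0 //; move=> *; apply: h0.
have Y0 : 0 <= Y by apply: sumr_ge0.
have tot : \sum_(u in setT) h u = X + Y.
  by rewrite (big_setID C) /= setTI setTD.
have muX : mu * X = (k%:R - 1) * X + k%:R * Y.
  rewrite /X mulr_sumr.
  transitivity (\sum_(u in C) (X + Y - h u)).
    apply: eq_bigr => u uC; rewrite heE nC // -tot [in RHS](big_setD1 u) ?inE //=.
    by rewrite [RHS]addrAC subrr add0r.
  by rewrite sumrB sumr_const cC -/X -[(X + Y) *+ _]mulr_natl; ring.
have muY : (n%:R - k%:R) * X <= mu * Y.
  have -> : n%:R - k%:R = #|~: C|%:R :> R.
    by rewrite cardsCs setCK card_ord cC natrB // ltnW.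
  rewrite mulr_natl -sumr_const /Y mulr_sumr; apply: ler_sum => u uC.
  rewrite heE [leRHS](big_setID C) /= [X in X + _](_ : _ = X) ?lerDl ?sumr_ge0 //.
  apply: eq_bigl => v; rewrite !inE /=; case: (boolP (v < k)%N) => vk; rewrite ?andbF // andbT.
  rewrite t_sym tC // ?inE //; apply: contraTneq uC => ->.
  by rewrite !inE vk.
have kR : 0 <= k%:R :> R by rewrite ler0n.
split=> //.
  rewrite -(ler_pM2r X0) muX lerDl mulr_ge0 //.
rewrite -(ler_pM2r X0).
have h1 : k%:R * ((n%:R - k%:R) * X) <= k%:R * (mu * Y) by apply: ler_wpM2l.
have h2 : mu * (mu * X) = mu * ((k%:R - 1) * X + k%:R * Y) by rewrite muX.
lra.
Qed.

(** [x1], which is [x] cut off outside [Z], has nonnegative defect [D] in the target. Pairing [D]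
    with the positive Perron vector of the target gives [(mu' - mu)] times a nonnegative number, so
    [D = 0]. A vertex outside [Z], joined to the hub in the target, or a missing edge would make [D]
    positive somewhere. *)
Lemma embedding_rigid e t (s : {perm 'I_n}) (K Z : {set 'I_n}) (mu mu' : R) x h :
  symmetric e -> symmetric t -> perron e setT mu x -> perron t setT mu' h ->
  (forall u, 0 < h u) -> mu' <= mu -> K != set0 -> K \subset Z ->
  (forall u v, u \in Z -> e u v -> v \in Z) -> {in Z, forall u, 0 < x u} ->
  {in Z &, forall u v, e u v -> t (s u) (s v)} ->
  {in K, forall kap u, u != kap -> t (s u) (s kap)} ->
  forall u v, e u v = t (s u) (s v).
Proof.
move=> e_sym t_sym [x0 _ xe _] [_ _ he _] hpos le K0 KZ cl xZ et tK.
pose H u v : R := (t (s u) (s v))%:R; pose g u := h (s u).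
pose x1 u := if u \in Z then x u else 0.
have x1_ge0 u : 0 <= x1 u by rewrite /x1; case: ifP.
have H0 u v : 0 <= H u v by rewrite ler0n.
have gE v : \sum_u H u v * g u = mu' * g v.
  rewrite /g -he ?inE // (sum_nbrs t setT (s v) h) [RHS](reindex_inj (@perm_inj _ s)) /=.
  by apply: eq_big => [u|u _]; rewrite ?inE // /H t_sym.
have xE u : \sum_v (e u v)%:R * x v = mu * x u.
  rewrite -xe ?inE // (sum_nbrs e setT u x).
  by apply: eq_bigl => v; rewrite inE.
have term u v : u \in Z -> (e u v)%:R * x v <= H u v * x1 v.
  move=> uZ; case E : (e u v); last by rewrite mul0r mulr_ge0.
  by have vZ := cl u v uZ E; rewrite /H /x1 vZ et.
pose D u := \sum_v H u v * x1 v - mu * x1 u.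
have D0 u : 0 <= D u.
  rewrite /D; case: (boolP (u \in Z)) => uZ.
    rewrite {2}/x1 uZ -xE subr_ge0; apply: ler_sum => v _; exact: term.
  rewrite {2}/x1 (negPf uZ) mulr0 subr0; apply: sumr_ge0 => v _; exact: mulr_ge0.
have Dz u : D u = 0.
  have : \sum_w g w * D w <= 0.
    have -> : \sum_w g w * D w = (mu' - mu) * \sum_w g w * x1 w.
      rewrite mulrBl !mulr_sumr.
      under eq_bigr do rewrite /D mulrBr mulr_sumr.
      rewrite sumrB exchange_big /=; congr (_ - _); last first.
        by apply: eq_bigr => w _; rewrite mulrCA.
      apply: eq_bigr => w _; rewrite mulrA -gE mulr_suml.
      by apply: eq_bigr => v _; ring.
    apply: mulr_le0_ge0; first by rewrite subr_le0.
    by apply: sumr_ge0 => w _; rewrite mulr_ge0 // ltW // hpos.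
  have gD w : 0 <= g w * D w by rewrite mulr_ge0 // ltW // hpos.
  move=> S; have /eqP : \sum_w g w * D w = 0 by apply/eqP; rewrite eq_le S sumr_ge0.
  rewrite psumr_eq0 // => /allP/(_ u (mem_index_enum _)) /=.
  by rewrite mulf_eq0 (gt_eqF (hpos _)) => /eqP.
have ZT u : u \in Z.
  apply/negPn/negP => uZ; have [kap kK] := set0Pn _ K0.
  have := Dz u; rewrite /D {2}/x1 (negPf uZ) mulr0 subr0 => /eqP.
  rewrite psumr_eq0 => [|v _]; last exact: mulr_ge0.
  move/allP/(_ kap (mem_index_enum _)) => /=.
  have kZ := subsetP KZ kap kK.
  rewrite /H tK //; last by apply: contraNneq uZ => ->.
  by rewrite mul1r /x1 kZ (gt_eqF (xZ _ kZ)).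
move=> u v; apply/idP/idP; first exact: et.
move=> tuv; apply/negPn/negP => nuv.
have := Dz u; rewrite /D {2}/x1 ZT -xE -sumrB => /eqP.
rewrite psumr_eq0 => [|w _]; last by rewrite subr_ge0 term.
move/allP/(_ v (mem_index_enum _)) => /=.
by rewrite /H tuv (negPf nuv) mul1r mul0r subr0 /x1 ZT (gt_eqF (xZ _ (ZT v))).
Qed.

End Comparison.

(** List [K], then [a], [b], then the rest; new labels are positions in this list. So [a] and [b]
    land on the ends of the extra edge of [Splus_edge]. *)
Lemma ex_perm_hub n (K : {set 'I_n}) a b : a \notin K -> b \notin K -> a != b ->
  exists s : {perm 'I_n}, [/\ forall u, (s u < #|K|)%N = (u \in K),
    s a = #|K| :> nat & s b = #|K|.+1 :> nat].
Proof.
move=> aK bK ab.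
pose L := enum K ++ [:: a; b] ++ enum (~: (K :|: [set a; b])).
have Lall u : u \in L.
  by rewrite !mem_cat !mem_enum !inE; case: (u \in K); case: (u == a); case: (u == b).
have Luniq : uniq L.
  rewrite !cat_uniq !enum_uniq /= !inE ab /= !mem_enum !negb_or aK bK andbT /=.
  apply/andP; split; apply/hasPn => u; rewrite !(inE, mem_enum) !negb_or.
    by case/andP.
  by case/and3P => _ -> ->.
have Lsize : size L = n.
  have -> : size L = #|'I_n|; last exact: card_ord.
  by rewrite -(card_uniqP Luniq); apply: eq_card => u; rewrite Lall.
have iL u : (index u L < n)%N by rewrite -[X in (_ < X)%N]Lsize index_mem.
have inj : injective (fun u => Ordinal (iL u)).
  move=> u v /(congr1 val) /= h.
  by rewrite -(nth_index u (Lall u)) h nth_index.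
exists (perm inj); split=> [u||]; rewrite permE /=.
- rewrite /L index_cat mem_enum cardE; case: ifP => uK; first by rewrite index_mem mem_enum.
  by rewrite ltnNge leq_addr.
- by rewrite /L index_cat mem_enum (negPf aK) -cardE /= eqxx addn0.
- by rewrite /L index_cat mem_enum (negPf bK) -cardE /= (negPf ab) eqxx addn1.
Qed.

(** * From the spectral hypothesis to the isomorphism *)

Section Extremal.
Variables (R : realType) (n k : nat) (e t : rel 'I_n) (muG muS : R).
Hypotheses (k0 : (0 < k)%N) (nk : (2 ^ (4 * k) <= n)%N).
Hypotheses (e_sym : symmetric e) (e_irr : irreflexive e).
Hypotheses (t_sym : symmetric t) (t_irr : irreflexive t)
  (St : forall u v, S_edge n k u v -> t u v).
Hypotheses (sG : short_paths e k setT) (specG : is_spectral_radius e muG)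
  (specS : is_spectral_radius t muS) (le_mu : muS <= muG).

Lemma order_gt : (k < n)%N.
Proof.
apply: leq_trans nk; apply: leq_trans (ltn_expl k (isT : 1 < 2)%N) _.
by rewrite leq_exp2l // leq_pmull.
Qed.

Lemma perron_nbr_gt0 (mu : R) x u v : perron e setT mu x -> 0 < x u -> e u v -> 0 < x v.
Proof.
move=> pG xu euv; have [x0 _ xe _] := pG.
rewrite lt_neqAle x0 andbT; apply/eqP => xv.
have := xe v (in_setT v); rewrite -xv mulr0 => /eqP; rewrite psumr_eq0 //.
move/allP/(_ u (mem_index_enum _)); rewrite !inE e_sym euv /= => /eqP h.
by rewrite h ltxx in xu.
Qed.

Lemma extremal_setup : exists (mu mu' : R) (x h : 'I_n -> R) (K M : {set 'I_n}),
  [/\ [/\ perron e setT mu x, perron t setT mu' h, forall u, 0 < h u & mu' <= mu],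
      k%:R * (n%:R - k%:R) <= mu ^+ 2 - (k%:R - 1) * mu, {in K, forall u, 0 < x u} &
      [/\ #|K| = k, (k + 3 <= #|M|)%N & {in K & M, forall u w, e u w}]].
Proof.
have n0 : (0 < n)%N := ltn_trans k0 order_gt.
have T0 : [set: 'I_n] != set0 by apply/set0Pn; exists (Ordinal n0); rewrite inE.
(* Perron pairs are chosen for all vertex sets at once, since the optimisation compares them; the
   empty set gets a dummy value. *)
have [f fP] : exists f : {set 'I_n} -> R * ('I_n -> R),
    forall B, B != set0 -> perron e B (f B).1 (f B).2.
  apply: (@fin_all_exists {set 'I_n} (fun=> (R * ('I_n -> R))%type)
    (fun B p => B != set0 -> perron e B p.1 p.2)) => B.
  have [->|B0] := eqVneq B set0; first by exists (0, fun=> 0).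
  by have [mu [x h]] := perron_exists R e_sym B0; exists (mu, x).
have [mu' [h pt]] := perron_exists R t_sym T0.
have kn : (0 < k < n)%N by rewrite k0 order_gt.
have [hpos hk hbig] := target_perron t_sym t_irr kn St pt.
pose mu := (f setT).1; pose x := (f setT).2.
have pG : perron e setT mu x := fP _ T0.
have le : mu' <= mu.
  apply: le_trans (eigenvalue_le_perron e_sym pG specG.1).
  by apply: le_trans le_mu; apply: specS.2; apply: perron_eigenvalue pt.
have [x0 xn xe _] := pG.
(* The Perron vector may vanish on whole components. Its support is closed under adjacency and keeps
   the spectral radius, and a hub found inside it has positive entries. *)
pose U := [set u | 0 < x u].
have U0 : U != set0.
  apply/eqP => UE; move: xn; rewrite big1 => [/eqP|u _]; first by rewrite eq_sym oner_eq0.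
  have : u \notin U by rewrite UE inE.
  rewrite inE -leNgt => xu; have -> : x u = 0 by apply/eqP; rewrite eq_le xu x0.
  by rewrite expr0n.
have leU : mu <= (f U).1.
  apply: (perron_closed pG (subsetT U) _ _ (fP U U0)).
    by have [u uU] := set0Pn _ U0; exists u => //; rewrite inE in uU.
  move=> u; rewrite inE => xu; apply/subsetP => v; rewrite !inE => /andP[_ euv].
  exact: perron_nbr_gt0 pG xu euv.
have mono (a b : R) : k%:R - 1 <= a -> a <= b ->
    k%:R * (n%:R - k%:R) <= a ^+ 2 - (k%:R - 1) * a ->
    k%:R * (n%:R - k%:R) <= b ^+ 2 - (k%:R - 1) * b.
  move=> ka ab; have : 0 <= k%:R - 1 :> R by rewrite subr_ge0 ler1n.
  set c := k%:R - 1 in ka *; set d := k%:R * _ => c0 hd; nra.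
have big := mono _ _ hk le hbig.
have kmu : k%:R - 1 <= mu := le_trans hk le.
have bigU := mono _ _ kmu leU big.
have sU : short_paths e k U.
  by move=> p up; apply: sG; apply: upath_sub up; apply: subsetT.
have [K [M [KU cK cM KM]]] :=
  ex_hub (mu := fun B => (f B).1) (px := fun B => (f B).2) e_sym e_irr fP k0 nk U0 sU bigU.
exists mu, mu', x, h, K, M; split=> //.
by move=> u /(subsetP KU); rewrite inE.
Qed.

(* It suffices to show that, inside the component of the hub, all edges avoiding
   the hub coincide with one edge [a b] that is present in the target. *)
Lemma extremal_iso :
  (forall (mu : R) x (K M : {set 'I_n}), perron e setT mu x ->
     k%:R * (n%:R - k%:R) <= mu ^+ 2 - (k%:R - 1) * mu -> {in K, forall u, 0 < x u} ->
     #|K| = k -> (k + 3 <= #|M|)%N -> {in K & M, forall u w, e u w} ->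
     exists a b, [/\ a \notin K, b \notin K, a != b &
       forall s : {perm 'I_n}, (forall u, (s u < k)%N = (u \in K)) ->
         s a = k :> nat -> s b = k.+1 :> nat ->
         {in hub_comp e K &, forall u v, u \notin K -> v \notin K -> e u v -> t (s u) (s v)}]) ->
  graph_iso e t.
Proof.
move=> H; have [mu [mu' [x [h [K [M [[pG pt hpos le] big xK [cK cM KM]]]]]]]] := extremal_setup.
have [a [b [aK bK ab ht]]] := H mu x K M pG big xK cK cM KM.
have [s [sK sa sb]] := ex_perm_hub aK bK ab; rewrite cK in sK sa sb.
have Kt u v : u \in K -> u != v -> t (s u) (s v).
  by move=> uK uv; apply: St; rewrite /S_edge (inj_eq perm_inj) uv sK uK.
have Knt u v : v \in K -> u != v -> t (s u) (s v).
  by move=> vK uv; rewrite t_sym Kt // eq_sym.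
exists s; apply: (@embedding_rigid R n e t s K (hub_comp e K) mu mu' x h) => //.
- by rewrite -card_gt0 cK.
- by rewrite /hub_comp -setUA subsetUl.
- exact: (hub_comp_closed e_sym e_irr cK cM KM sG).
- have posR c : c \in hub_roots e K -> 0 < x c.
    case/rootsP => _ [kap kK eck]; apply: (perron_nbr_gt0 pG (xK _ kK)).
    by rewrite e_sym.
  move=> u; rewrite !in_setU => /orP[/orP[/xK//|/posR//]|/bigcupP[c /posR xc]].
  by rewrite inE => /andP[_ ecu]; apply: perron_nbr_gt0 pG xc ecu.
- move=> u v uZ vZ euv; have uv : u != v by apply: contraTneq euv => ->; rewrite e_irr.
  have [uK|uK] := boolP (u \in K); first exact: Kt.
  have [vK|vK] := boolP (v \in K); first exact: Knt.
  by apply: ht => //; split.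
- by move=> kap kK u uk; apply: Knt.
Qed.

End Extremal.

Lemma hub_two_outside (n k : nat) (e : rel 'I_n) (K M : {set 'I_n}) : irreflexive e ->
  {in K & M, forall u w, e u w} -> (k + 3 <= #|M|)%N ->
  exists a b, [/\ a \notin K, b \notin K & a != b].
Proof.
move=> e_irr KM cM.
have /card_gt1P[a [b [aM bM ab]]] : (1 < #|M|)%N by apply: leq_trans cM; rewrite addn3.
exists a, b; split=> //; [move: aM | move: bM]; apply: contraL; exact: (hub_disjoint e_irr KM).
Qed.

Lemma S_edge_sym n k : symmetric (S_edge n k).
Proof. by move=> u v; rewrite /S_edge eq_sym orbC. Qed.

Lemma S_edge_irr n k : irreflexive (S_edge n k).
Proof. by move=> u; rewrite /S_edge eqxx. Qed.

Lemma Splus_edge_sym n k : symmetric (Splus_edge n k).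
Proof.
move=> u v; rewrite /Splus_edge S_edge_sym; congr (_ || _).
by rewrite orbC andbC [X in _ || X]andbC.
Qed.

Lemma Splus_edge_irr n k : irreflexive (Splus_edge n k).
Proof.
move=> u; rewrite /Splus_edge S_edge_irr /= andbC orbb.
by apply/negP => /andP[/eqP -> /eqP]; lia.
Qed.

Theorem theorem1 (R : realType) (k n : nat) (e : rel 'I_n) :
  (1 <= k)%N -> (2 ^ (4 * k) <= n)%N -> simple_graph e ->
  (forall muG muS : R,
     is_spectral_radius e muG -> is_spectral_radius (S_edge n k) muS ->
     muS <= muG ->
     has_path n (2 * k + 2) e \/ graph_iso e (S_edge n k)) /\
  (forall muG muS : R,
     is_spectral_radius e muG -> is_spectral_radius (Splus_edge n k) muS ->
     muS <= muG ->
     has_path n (2 * k + 3) e \/ graph_iso e (Splus_edge n k)).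
Proof.
move=> k0 nk [e_sym e_irr]; split=> muG muS sG sS le.
- have [|short] := path_or_short (2 * k + 2) e; [by left | right].
  have sP : short_paths e k setT by move=> p /short /ltnW.
  apply: (@extremal_iso R n k e _ muG muS) => //.
  + exact: S_edge_sym.
  + exact: S_edge_irr.
  move=> mu x K M pG big xK cK cM KM.
  (* An edge avoiding the hub would give a path on [2k+2] vertices, so the condition on [a] and [b]
     is vacuous and any two vertices outside [K] serve. *)
  have [a [b [aK bK ab]]] := hub_two_outside e_irr KM cM.
  exists a, b; split=> // s _ _ _ u v uZ vZ uK vK euv; exfalso.
  have vu : v \in wnbrs e K u by rewrite !inE vK.
  have no w w' : w \in hub_roots e K -> w' \notin K -> e w' w -> False.
    move=> /rootsP[wK [kap kK ek]] wK' eww.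
    have [p /short] := hub_path2 u e_sym e_irr cK cM KM kK wK' wK eww ek.
    by move=> + pE; rewrite pE ltnn.
  have [ur|vr] := hub_edge_root e_sym e_irr cK cM KM sP uZ uK vu.
    by apply: (no u v) => //; rewrite e_sym.
  exact: (no v u).
have [|short] := path_or_short (2 * k + 3) e; [by left | right].
have sP : short_paths e k setT by move=> p /short; rewrite addn3 addn2.
apply: (@extremal_iso R n k e _ muG muS) => //.
- exact: Splus_edge_sym.
- exact: Splus_edge_irr.
- by move=> u v; rewrite /Splus_edge => ->.
move=> mu x K M pG big xK cK cM KM.
have root_edge u v : u \in hub_comp e K -> u \notin K -> v \notin K -> e u v ->
    exists c b, [/\ c \in hub_roots e K, b \in wnbrs e K c &
      (u = c /\ v = b) \/ (u = b /\ v = c)].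
  move=> uZ uK vK euv; have vu : v \in wnbrs e K u by rewrite !inE vK.
  have [ur|vr] := hub_edge_root e_sym e_irr cK cM KM sP uZ uK vu.
    by exists u, v; split=> //; left.
  by exists v, u; split=> //; [apply: wnbrs_sym | right].
(* Without a root edge the choice of [a] and [b] is again arbitrary. Otherwise one root edge is laid
   on the extra edge of the target, and a second one is excluded by weights. *)
have [c cE|no] := pickP (fun c => (c \in hub_roots e K) && (wnbrs e K c != set0)); last first.
  have [a [b [aK bK ab]]] := hub_two_outside e_irr KM cM.
  exists a, b; split=> // s _ _ _ u v uZ vZ uK vK euv; exfalso.
  have [c [d [cr dc _]]] := root_edge u v uZ uK vK euv.
  by have := no c; rewrite cr /= => /negbFE/eqP E; rewrite E inE in dc.
case/andP: cE => cr /set0Pn[b bc].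
have cK' : c \notin K by have [] := rootsP _ _ _ cr.
have [bK ecb] : b \notin K /\ e c b by move: bc; rewrite !inE => /andP[].
exists c, b; split=> //; first by apply: contraTneq ecb => ->; rewrite e_irr.
move=> s sK sc sb u v uZ vZ uK vK euv.
have [d [f [dr fd duf]]] := root_edge u v uZ uK vK euv.
have [/orP h|h] := boolP (((d == c) && (f == b)) || ((d == b) && (f == c))).
  apply/orP; right.
  by case: h => /andP[/eqP dE /eqP fE]; case: duf => -[-> ->]; rewrite dE fE sc sb !eqxx ?orbT.
exfalso; apply: (two_root_edges_absurd e_sym e_irr k0 cK cM KM sP pG xK big cr bc dr fd).
by case=> -[dE fE]; case/negP: h; rewrite dE fE !eqxx ?orbT.
Qed.
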